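(* Let $s\in(0,1)$ and $p>1$ satisfy $2<sp<p$. Let $\Omega\subset\mathbb{R}^2$ be the Koch snowflake domain and, for $n\in\mathbb{N}$, let $\Omega_n$ be its $n$-th pre-fractal polygonal approximation. Let $f\in L^1(\Omega)$, let $b\in C(\overline\Omega)$ with $b(x)>0$ for all $x\in\overline\Omega$, let $\delta_n>0$ be a constant, let $\varphi_{1,n},\varphi_{2,n}\in W^{s,p}(\Omega)$ with $\varphi_{1,n}\le\varphi_{2,n}$ in $\Omega$, and assume that $\mathcal{K}^n=\{v\in W^{s,p}(\Omega_n):\varphi_{1,n}\le v\le\varphi_{2,n}\text{ in }\Omega_n\}\neq\emptyset$. Then the problem $$\min_{v\in\mathcal{K}^n}J_{p,n}(v),\qquad J_{p,n}(v)=\frac1p\iint_{\Omega_n\times\Omega_n}\frac{|v(x)-v(y)|^p}{|x-y|^{2+sp}}\,dx\,dy-\int_{\Omega_n}f(x)v(x)\,dx+\frac{\delta_n}{p}\int_{\partial\Omega_n}b(x)|v(x)|^p\,d\ell,$$ admits a unique solution.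
   Context: The Koch snowflake $K\subset\mathbb{R}^2$ is the closed curve which is the union of three coplanar Koch curves built on the sides of an equilateral triangle, and $\Omega$ is the bounded open domain with $\partial\Omega=K$. For $n\in\mathbb{N}$, $K_n$ is the $n$-th pre-fractal closed polygonal curve approximating $K$ (with $3\cdot4^n$ segments), and $\Omega_n$ is the bounded open polygonal domain with $\partial\Omega_n=K_n$; the $\Omega_n$ form an increasing sequence exhausting $\Omega$. $d\ell$ denotes arc-length measure on $K_n$. $W^{s,p}(\mathcal{G})$ ($\mathcal{G}=\Omega$ or $\Omega_n$) is the fractional Sobolev space with norm $\|u\|^p_{W^{s,p}(\mathcal{G})}=\|u\|^p_{L^p(\mathcal{G})}+\iint_{\mathcal{G}\times\mathcal{G}}\frac{|u(x)-u(y)|^p}{|x-y|^{2+sp}}dx\,dy$. Values on $\partial\Omega_n$ are understood as traces, $u(x)=\lim_{r\to0}\frac{1}{|B(x,r)\cap\Omega_n|}\int_{B(x,r)\cap\Omega_n}u(y)\,dy$ (since $sp>2$ these functions have continuous representatives). *)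

(* Defs.v *)
From HB Require Import structures.
From mathcomp Require Import all_boot all_order all_algebra.
From mathcomp Require Import all_classical all_reals all_analysis.

Set Implicit Arguments.
Unset Strict Implicit.
Unset Printing Implicit Defensive.

Import Order.TTheory GRing.Theory Num.Theory.
Import numFieldNormedType.Exports.

Local Open Scope classical_set_scope.
Local Open Scope ring_scope.

Section Plane.
Variable R : realType.
Implicit Types (x y z : R * R) (D : set (R * R)) (u : R * R -> R).

(* The norm of the library on [R * R] is the sup norm. *)
Definition enorm z : R := Num.sqrt (z.1 ^+ 2 + z.2 ^+ 2).

Definition eball x (r : R) : set (R * R) := [set y | enorm (x - y) < r].

Definition boundary D : set (R * R) := closure D `\` interior D.

Definition bounded_domain_of (K D : set (R * R)) : Prop :=
  [/\ open D, connected D, bounded_set D & boundary D = K].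

Definition area : set (measurableTypeR R * measurableTypeR R) -> \bar R :=
  (@lebesgue_measure R \x @lebesgue_measure R)%E.

HB.instance Definition _ := Measure.on area.

Let area_sigma_finite : sigma_finite setT area.
Proof.
have /sigma_finiteP[F [TF ndF Foo]] := sigma_finiteT (@lebesgue_measure R).
exists (fun n => F n `*` F n).
  rewrite -setXTT TF predeqE => -[x y]; split.
    move=> [/= [n _ Fnx] [k _ Fky]]; exists (maxn n k) => //; split.
    - by move: x Fnx; exact/subsetPset/ndF/leq_maxl.
    - by move: y Fky; exact/subsetPset/ndF/leq_maxr.
  by move=> [n _ []/= ? ?]; split; exists n.
move=> k; have [? ?] := Foo k.
split; first exact: measurableX.
by rewrite /area product_measure1E// lte_mul_pinfty// ge0_fin_numE.
Qed.

HB.instance Definition _ :=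
  @isSigmaFinite.Build _ _ _ area area_sigma_finite.

End Plane.

Arguments area : clear implicits.

Section Koch.
Variable R : realType.
Implicit Types (P Q z : R * R) (e : (R * R) * (R * R)).

(* With the plane read as the complex numbers, [place e] is the direct
   similarity [z |-> e.1 + (e.2 - e.1) * z], which carries the oriented unit
   segment from 0 to 1 onto the oriented segment [e]. *)
Definition place e z : R * R :=
  (e.1.1 + (e.2.1 - e.1.1) * z.1 - (e.2.2 - e.1.2) * z.2,
   e.1.2 + (e.2.2 - e.1.2) * z.1 + (e.2.1 - e.1.1) * z.2).

Definition segment_set e : set (R * R) :=
  [set place e (t, 0) | t in `[0, 1]%classic].

(* The middle third is replaced by the two other sides of the equilateral
   triangle that lies to the right of [e]. *)
Definition koch_split e : seq ((R * R) * (R * R)) :=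
  let p1 := place e (3^-1, 0) in
  let p2 := place e (2^-1, - (Num.sqrt 3 / 6)) in
  let p3 := place e (2 / 3, 0) in
  [:: (e.1, p1); (p1, p2); (p2, p3); (p3, e.2)].

(* Sides of the equilateral triangle with base [P Q], counterclockwise, so that
   the outside is to the right of each side. Every equilateral triangle is
   obtained from some [P != Q]. *)
Definition triangle_sides P Q : seq ((R * R) * (R * R)) :=
  let T := place (P, Q) (2^-1, Num.sqrt 3 / 2) in
  [:: (P, Q); (Q, T); (T, P)].

Definition koch_segments P Q (n : nat) : seq ((R * R) * (R * R)) :=
  iter n (fun l => flatten (map koch_split l)) (triangle_sides P Q).

Definition segments_union (l : seq ((R * R) * (R * R))) : set (R * R) :=
  \bigcup_(e in [set` l]) segment_set e.

(* The Koch curve on the unit segment is the unique nonempty compact set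
   invariant under the four similarities of ratio 1/3. *)
Definition unit_koch_curve (C : set (R * R)) : Prop :=
  [/\ compact C, C !=set0 &
      C = \bigcup_(e in [set` koch_split ((0, 0), (1, 0))]) (place e @` C)].

Definition koch_snowflake P Q (K : set (R * R)) : Prop :=
  exists2 C, unit_koch_curve C &
    K = \bigcup_(e in [set` triangle_sides P Q]) (place e @` C).

Definition arclength_integral (l : seq ((R * R) * (R * R)))
    (g : R * R -> R) : \bar R :=
  (\sum_(e <- l) (enorm (e.2 - e.1))%:E *
     \int[lebesgue_measure]_(t in `[0%R, 1%R]) (g (place e (t, 0%R)))%:E)%E.

End Koch.

Section Sobolev.
Variable R : realType.
Implicit Types (s p : R) (x y : R * R) (D : set (R * R)) (u v : R * R -> R).

Definition gagliardo s p D u : \bar R :=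
  (\int[area R \x area R]_(z in D `*` D)
     (`|u z.1 - u z.2| `^ p / enorm (z.1 - z.2) `^ (2 + s * p))%:E)%E.

(* Functions stand for their classes modulo equality almost everywhere on
   [D]. *)
Definition sobolev s p D : set (R * R -> R) :=
  [set u : R * R -> R | [/\ measurable_fun D u,
               (\int[area R]_(x in D) (`|u x| `^ p)%:E < +oo)%E &
               (gagliardo s p D u < +oo)%E]].

Definition trace D u x : R :=
  lim ((fun r : R =>
    (fine (area R (eball x r `&` D)))^-1 *
      (\int[area R]_(y in eball x r `&` D) u y)%R) @ 0^'+).

Definition ae_le_on D u v : Prop :=
  {ae area R, forall x, D x -> u x <= v x}.

Definition obstacle_set s p D (phi1 phi2 : R * R -> R) : set (R * R -> R) :=
  [set v : R * R -> R | [/\ sobolev s p D v, ae_le_on D phi1 v & ae_le_on D v phi2]].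

(* [l] lists the sides of the polygon bounding [D]. *)
Definition energy s p D l (f b : R * R -> R) (delta : R) v : \bar R :=
  (p^-1%:E * gagliardo s p D v
   - \int[area R]_(x in D) (f x * v x)%:E
   + (delta / p)%:E *
     arclength_integral l (fun x => (b x * `|trace D v x| `^ p)%R))%E.

Definition minimizer (A : set (R * R -> R)) (J : (R * R -> R) -> \bar R) v :=
  A v /\ forall w, A w -> (J v <= J w)%E.

End Sobolev.

(* Main.v *)
Require Import Defs.
From HB Require Import structures.
From mathcomp Require Import all_boot all_order all_algebra.
From mathcomp Require Import all_classical all_reals all_analysis.
From mathcomp Require Import measurable_realfun ring lra.

(** The functional is uniformly convex, by Clarkson's inequality for p > 2, so that
    minimizing sequences are Cauchy; and since s p > 2 makes functions of finite seminorm
    Hölder continuous, they are uniformly Cauchy, which is enough for the direct method.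

    Write D for the polygonal domain. The geometric input is that D is open and bounded
    and that its boundary lies on finitely many lines. These lines cut the plane into open
    convex cells, each contained in D or disjoint from D; contracting a cell towards one of
    its points shows that D fills a fixed proportion of every small disc centred on its
    closure ([measure_density_closure]). For the Koch polygon, it remains to see that the
    sides do not degenerate ([koch_segments_nondegenerate]).

    Measure density and a finite seminorm over D * D make the means of u over the sets
    B(x, r) cap D converge geometrically as r tends to 0, at every x of the closure
    ([mean_disc_radii]). Hence the trace exists on the whole closure, is Hölder
    continuous there ([trace_holder]) and equals u almost everywhere ([trace_eq_ae]). The
    seminorm being nonlocal, it also controls the distance from u to its mean over D
    ([precise_osc]). Each class thus has a precise representative, equal to its own
    trace, and the energy is unchanged when a function is replaced by it
    ([energy_trace]). The two obstacles, hence all competitors, are bounded, so that the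
    linear term makes sense and the energy is bounded below.

    For precise u and w, Clarkson's inequality gives
      J((u + w) / 2) + [(u - w) / 2]^p / p + (delta / p) int b |(u - w) / 2|^p
        <= (J(u) + J(w)) / 2
    ([energyR_clarkson]), where [v]^p is the double integral of the seminorm. If u and w
    are almost minimizers, the last two terms on the left are small; the seminorm
    controls the oscillation of u - w, and the boundary integral, where b is positive,
    controls its mean, so that u - w is uniformly small ([near_minimizers]). A minimizing
    sequence is therefore uniformly Cauchy on the closure. Its limit is admissible and,
    by Fatou's lemma, minimizes the energy ([admissible_minimizer]). The same estimate
    gives uniqueness ([admissible_unique]). *)

Set Implicit Arguments.
Unset Strict Implicit.
Unset Printing Implicit Defensive.

Import Order.TTheory GRing.Theory Num.Theory.
Import numFieldNormedType.Exports.

Local Open Scope classical_set_scope.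
Local Open Scope ring_scope.

(** * The Euclidean norm and the topology of the plane *)

Section Enorm.
Variable R : realType.
Implicit Types (x y z : R * R) (r : R) (D : set (R * R)).

Lemma enorm_ge0 z : 0 <= enorm z.
Proof. exact: sqrtr_ge0. Qed.

Lemma enorm0 : enorm (0 : R * R) = 0.
Proof. by rewrite /enorm /= expr0n/= addr0 sqrtr0. Qed.

Lemma enormB x y : enorm (x - y) = enorm (y - x).
Proof. by rewrite /enorm/=; congr Num.sqrt; ring. Qed.

Lemma sqr_enorm z : enorm z ^+ 2 = z.1 ^+ 2 + z.2 ^+ 2.
Proof. by rewrite sqr_sqrtr// addr_ge0 ?sqr_ge0. Qed.

Lemma enorm_eq0 z : enorm z = 0 -> z = 0.
Proof.
case: z => a b /(congr1 (fun t => t ^+ 2)); rewrite sqr_enorm expr0n/=.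
move/eqP; rewrite paddr_eq0 ?sqr_ge0// !sqrf_eq0 => /andP[/eqP -> /eqP ->].
by [].
Qed.

Lemma enormZ k z : enorm (k * z.1, k * z.2) = `|k| * enorm z.
Proof.
rewrite /enorm/= !exprMn -mulrDr sqrtrM ?sqr_ge0//.
by rewrite sqrtr_sqr.
Qed.

Lemma normr_fst_enorm z : `|z.1| <= enorm z.
Proof.
by rewrite -sqrtr_sqr ler_sqrt ?lerDl ?sqr_ge0// addr_ge0 ?sqr_ge0.
Qed.

Lemma normr_snd_enorm z : `|z.2| <= enorm z.
Proof.
by rewrite -sqrtr_sqr ler_sqrt ?lerDr ?sqr_ge0// addr_ge0 ?sqr_ge0.
Qed.

Lemma enorm_le_sum z : enorm z <= `|z.1| + `|z.2|.
Proof.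
rewrite -(@ler_sqr _ (enorm z)) ?nnegrE ?addr_ge0 ?enorm_ge0//.
rewrite sqr_enorm sqrrD !real_normK ?num_real// lerD2r lerDl.
by rewrite mulrn_wge0// mulr_ge0.
Qed.

(** The square of the scalar product is below the product of the squared norms, the
    difference being the square of the determinant. *)
Lemma enormD x y : enorm (x + y) <= enorm x + enorm y.
Proof.
rewrite -(@ler_sqr _ (enorm _)) ?nnegrE ?addr_ge0 ?enorm_ge0//.
rewrite (sqr_enorm (x + y)) (sqrrD (enorm x)) (sqr_enorm x) (sqr_enorm y)/=.
have CS : x.1 * y.1 + x.2 * y.2 <= enorm x * enorm y.
  apply: (le_trans (ler_norm _)).
  rewrite -(@ler_sqr _ `| _ |) ?nnegrE ?mulr_ge0 ?enorm_ge0// real_normK ?num_real//.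
  rewrite exprMn !sqr_enorm -subr_ge0.
  rewrite (_ : _ - _ = (x.1 * y.2 - x.2 * y.1) ^+ 2) ?sqr_ge0//; ring.
nra.
Qed.

Lemma enorm_tri y x z : enorm (x - z) <= enorm (x - y) + enorm (y - z).
Proof. by rewrite -[x - z](subrKA y) enormD. Qed.

Lemma closure_enorm D x :
  closure D x <-> forall r, 0 < r -> exists2 y, D y & enorm (x - y) < r.
Proof.
split=> [cDx r r0|h A].
  have /cDx[y [Dy [/= b1 b2]]] : nbhs x (ball x (r / 2)).
    by apply: nbhsx_ballx; rewrite divr_gt0.
  exists y => //; apply: (le_lt_trans (enorm_le_sum _)).
  rewrite [ltRHS](splitr r); apply: ltrD; [exact: b1|exact: b2].
move=> /nbhs_ballP[e /= e0 eA]; have [y Dy ye] := h _ e0.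
exists y; split => //; apply: eA; split.
  by apply: le_lt_trans ye; exact: (normr_fst_enorm (x - y)).
by apply: le_lt_trans ye; exact: (normr_snd_enorm (x - y)).
Qed.

Lemma open_enorm D :
  open D <-> forall x, D x -> exists2 r, 0 < r & eball x r `<=` D.
Proof.
rewrite openE; split=> [oD x /oD /nbhs_ballP[e /= e0 eA]|oD x /oD[r r0 rD]].
  exists e => // y ye; apply: eA; split.
    by apply: le_lt_trans ye; exact: (normr_fst_enorm (x - y)).
  by apply: le_lt_trans ye; exact: (normr_snd_enorm (x - y)).
apply/nbhs_ballP; exists (r / 2); first by rewrite /= divr_gt0.
move=> y [y1 y2]; apply: rD; apply: (le_lt_trans (enorm_le_sum _)).
by rewrite [ltRHS]splitr; apply: ltrD; [exact: y1|exact: y2].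
Qed.

Lemma bounded_enorm D : bounded_set D -> exists2 d, 0 < d &
  forall x, closure D x -> D `<=` eball x d.
Proof.
move=> [M [_ /(_ (`|M| + 1))]] hM.
have {}hM : forall y, D y -> `|y| <= `|M| + 1.
  by apply: hM; rewrite (le_lt_trans (ler_norm _))// ltrDl.
have DM y : D y -> enorm y <= 2 * (`|M| + 1).
  move=> /hM; rewrite prod_normE ge_max => /andP[y1 y2].
  by apply: (le_trans (enorm_le_sum _)); lra.
exists (4 * (`|M| + 1) + 1); first by rewrite ltr_wpDl ?mulr_ge0// addr_ge0.
move=> x /closure_enorm/(_ _ ltr01)[z Dz xz] y Dy; rewrite /eball/=.
apply: (le_lt_trans (enorm_tri z _ _)).
have := DM _ Dy; have := DM _ Dz => hz hy.
have := enormD z (- y); rewrite -[- y]sub0r [enorm (0 - _)]enormB subr0 sub0r => h.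
lra.
Qed.

End Enorm.

Section PlaneMeasure.
Variable R : realType.
Implicit Types (x y z : R * R) (r : R) (D : set (R * R)).
Local Notation plane := (measurableTypeR R * measurableTypeR R)%type.

(** An open set is a countable union of open boxes with rational vertices. *)
Lemma open_measurable_plane (A : set plane) : open (A : set (R * R)) -> measurable A.
Proof.
move=> oA.
pose box (q : (rat * rat) * (rat * rat)) : set plane :=
  `]ratr q.1.1, ratr q.1.2[%classic `*` `]ratr q.2.1, ratr q.2.2[%classic.
pose I := [set q | box q `<=` A].
have -> : A = \bigcup_(q in I) box q.
  apply/seteqP; split => [[a b] Aab|x [q Iq]]; last exact: Iq.
  move: oA; rewrite openE => /(_ _ Aab)/nbhs_ballP[e /= e0 eA].
  have rb (c : R) : exists q : rat * rat,
      `]ratr q.1, ratr q.2[%classic `<=` ball c e /\ `]ratr q.1, ratr q.2[%classic c.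
    have [q1 /itvP q1e] := @rat_in_itvoo R (c - e) c ltac:(rewrite ltrBlDr ltrDl//).
    have [q2 /itvP q2e] := @rat_in_itvoo R c (c + e) ltac:(rewrite ltrDl//).
    exists (q1, q2); split=> /= [t|]; rewrite /= in_itv/= ?q1e ?q2e//.
    move=> /andP[t1 t2]; rewrite /ball/= ltr_distlC.
    by rewrite (lt_trans _ t1) ?q1e//= (lt_trans t2)// q2e.
  have [qa [qa1 qa2]] := rb a; have [qb [qb1 qb2]] := rb b.
  exists (qa, qb); last by split.
  move=> [t1 t2] [/= h1 h2]; apply: eA; split; [exact: qa1|exact: qb1].
rewrite bigcup_mkcond; apply: countable_bigcupT_measurable.
  exact: countableP.
move=> q; case: ifPn => // _; apply: measurableX; exact: measurable_itv.
Qed.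

End PlaneMeasure.

(** * Measure density of domains bounded by finitely many lines *)

Section Density.
Variable R : realType.
Implicit Types (x y z : R * R) (r t : R) (D C : set (R * R)).
Implicit Types (e : (R * R) * (R * R)) (l : seq ((R * R) * (R * R))).
Local Notation plane := (measurableTypeR R * measurableTypeR R)%type.

Definition interp x y t : R * R :=
  (x.1 + t * (y.1 - x.1), x.2 + t * (y.2 - x.2)).

Definition convex_set C := forall x y t,
  C x -> C y -> 0 <= t <= 1 -> C (interp x y t).

(** The determinant of the direction of [e] and of the vector from [e.1] to [x]: it
    vanishes exactly on the line through [e] when [e] does not degenerate, and its sign
    tells the two half-planes apart. *)
Definition side e x : R :=
  (e.2.1 - e.1.1) * (x.2 - e.1.2) - (e.2.2 - e.1.2) * (x.1 - e.1.1).

Lemma side_segment e x : segment_set e x -> side e x = 0.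
Proof. by move=> [t _ <-]; rewrite /side /place/=; ring. Qed.

Lemma side_interp e x y t :
  side e (interp x y t) = (1 - t) * side e x + t * side e y.
Proof. by rewrite /side /interp/=; ring. Qed.

Lemma interp0 x y : interp x y 0 = x.
Proof. by rewrite /interp !mul0r !addr0; case: x. Qed.

Lemma interpxx x t : interp x x t = x.
Proof. by rewrite /interp !subrr mulr0 !addr0; case: x. Qed.

Lemma interp1 x y : interp x y 1 = y.
Proof. by case: y => a b; rewrite /interp/=; congr pair; ring. Qed.

Lemma enorm_interp x y z t :
  enorm (interp x y t - interp x z t) = `|t| * enorm (y - z).
Proof. by rewrite -enormZ /enorm/=; congr Num.sqrt; ring. Qed.

Lemma continuous_interp x y : continuous (interp x y).
Proof.
have affine (a b : R) : continuous (fun t : R => a + t * b).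
  move=> t; apply: cvgD; first exact: cvg_cst.
  by apply: cvgM; [exact: cvg_id|exact: cvg_cst].
move=> t; apply: (@cvg_pair _ _ _ _ (nbhs _) (nbhs _)); exact: affine.
Qed.

(** Along a segment starting in [D] and staying in [C], being in [D] is both an open
    and a closed condition, since leaving [D] requires crossing its boundary. *)
Lemma convex_sub_open C D : open D -> convex_set C ->
  C `&` boundary D `<=` set0 -> C `&` D !=set0 -> C `<=` D.
Proof.
move=> oD cC Cb [x [Cx Dx]] y Cy.
have cl z : C z -> closure D z -> D z.
  move=> Cz cDz; apply: contrapT => Dz; apply: (Cb z); split => //.
  by split => //; rewrite interior_id in oD; rewrite oD.
(* On the segment, the preimages of [D] and of its closure coincide. *)
have E : `[0, 1]%classic `&` interp x y @^-1` D = `[0, 1]%classic.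
  apply: (@segment_connected R 0 1).
  - exists 0; split; first by rewrite /= in_itv/= lexx ler01.
    by rewrite /= interp0.
  - exists (interp x y @^-1` D) => //.
    by apply: open_comp => // t _; exact: continuous_interp.
  - exists (interp x y @^-1` closure D).
      apply: (@preimage_closed _ _ (interp x y)) => [t _|]; last exact: closed_closure.
      exact: continuous_interp.
    apply/seteqP; split => t [t01 /= Dt]; split => //.
      exact: subset_closure.
    by apply: cl => //; apply: cC => //; move: t01; rewrite /= in_itv.
have : (`[0, 1]%classic `&` interp x y @^-1` D) 1.
  by rewrite E /= in_itv/= lexx ler01.
by move=> [_ /=]; rewrite interp1.
Qed.

Lemma side_lipschitz e x y : `|side e y - side e x| <=
  (`|e.2.1 - e.1.1| + `|e.2.2 - e.1.2|) * enorm (x - y).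
Proof.
have -> : side e y - side e x =
    (e.2.1 - e.1.1) * (y.2 - x.2) - (e.2.2 - e.1.2) * (y.1 - x.1).
  by rewrite /side; ring.
rewrite (le_trans (ler_normB _ _))// !normrM mulrDl lerD//.
  rewrite ler_wpM2l// distrC; exact: (normr_snd_enorm (x - y)).
rewrite ler_wpM2l// distrC; exact: (normr_fst_enorm (x - y)).
Qed.

Lemma side_stable e x : side e x != 0 -> exists2 r, 0 < r &
  forall y, enorm (x - y) < r -> 0 < side e x * side e y.
Proof.
move=> sx; set c := `|e.2.1 - e.1.1| + `|e.2.2 - e.1.2|.
have c0 : 0 <= c by rewrite addr_ge0.
exists (`|side e x| / (c + 1)) => [|y].
  by rewrite divr_gt0 ?normr_gt0// ltr_wpDl.
rewrite ltr_pdivlMr ?ltr_wpDl// => xy.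
have := side_lipschitz e x y; rewrite -/c => h.
have {}h : `|side e y - side e x| < `|side e x|.
  apply: (le_lt_trans h); apply: le_lt_trans xy.
  by rewrite mulrDr mulr1 mulrC lerDl enorm_ge0.
have [s0|s0|s0] := ltgtP (side e x) 0; last by rewrite s0 eqxx in sx.
  rewrite nmulr_rgt0//; move: h; rewrite (ltr0_norm s0) ltr_norml; lra.
rewrite pmulr_rgt0//; move: h; rewrite (gtr0_norm s0) ltr_norml; lra.
Qed.

Lemma off_lines_stable l x : (forall e, e \in l -> side e x != 0) ->
  exists2 r, 0 < r &
    forall y, enorm (x - y) < r -> forall e, e \in l -> side e y != 0.
Proof.
elim: l => [_|e l IH h]; first by exists 1.
have [|r1 r10 h1] := IH; first by move=> e' e'l; apply: h; rewrite inE e'l orbT.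
have [r2 r20 h2] := side_stable (h e (mem_head _ _)).
exists (Num.min r1 r2); first by rewrite lt_min r10.
move=> y; rewrite lt_min => /andP[y1 y2] e'; rewrite inE => /predU1P[->|].
  by have := h2 _ y2; apply: contraTneq => ->; rewrite mulr0 ltxx.
exact: h1.
Qed.

(** Lines are treated one at a time: a point on the current line is moved along the
    normal, by so little that it stays off the previous ones. *)
Lemma off_lines_dense l x r : (forall e, e \in l -> e.1 != e.2) -> 0 < r ->
  exists2 y, enorm (x - y) < r & forall e, e \in l -> side e y != 0.
Proof.
move=> + r0; elim: l => [_|e l IH h].
  by exists x => //; rewrite subrr enorm0.
have [|y xy yl] := IH; first by move=> e' e'l; apply: h; rewrite inE e'l orbT.
have [ey|ey] := eqVneq (side e y) 0; last first.
  by exists y => // e'; rewrite inE => /predU1P[->//|]; exact: yl.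
have [r1 r10 hr1] := off_lines_stable yl.
set d := (e.2.1 - e.1.1, e.2.2 - e.1.2).
have d0 : 0 < enorm d.
  rewrite lt_neqAle enorm_ge0 andbT eq_sym; apply: contra (h e (mem_head _ _)).
  move=> /eqP/enorm_eq0[] /eqP + /eqP; rewrite !subr_eq0 => /eqP a /eqP b.
  by case: e a b {h ey d} => [[? ?] [? ?]] /= -> ->.
set m := Num.min r1 (r - enorm (x - y)).
have m0 : 0 < m by rewrite lt_min r10 subr_gt0.
set t := m / 2 / enorm d.
have t0 : 0 < t by rewrite !divr_gt0.
(* [d] is the direction of the line, and [y'] is [y] moved by [t] times the normal. *)
set y' := (y.1 - t * d.2, y.2 + t * d.1).
have yy' : enorm (y - y') < m.
  have -> : enorm (y - y') = enorm (t * d.1, t * d.2).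
    by rewrite /enorm/=; congr Num.sqrt; ring.
  rewrite enormZ gtr0_norm// /t divfK ?gt_eqF//; lra.
exists y'.
  apply: (le_lt_trans (enorm_tri y _ _)); rewrite -ltrBrDl.
  by apply: (lt_le_trans yy'); rewrite ge_min lexx orbT.
move=> e'; rewrite inE => /predU1P[->|]; last first.
  by apply: hr1; apply: (lt_le_trans yy'); rewrite ge_min lexx.
have -> : side e y' = side e y + t * (enorm d) ^+ 2.
  by rewrite sqr_enorm /side /y' /d/=; ring.
by rewrite ey add0r gt_eqF// mulr_gt0// exprn_gt0.
Qed.

Lemma measurable_eball x r : measurable (eball x r : set plane).
Proof.
apply: open_measurable_plane; apply/open_enorm => y /= xy.
exists (r - enorm (x - y)); first by rewrite subr_gt0.
move=> z yz; rewrite /eball/=; apply: (le_lt_trans (enorm_tri y _ _)).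
by rewrite -ltrBrDl.
Qed.

Lemma area_box (a b c d : R) : a <= b -> c <= d ->
  area R (`]a, b[%classic `*` `]c, d[%classic) = ((b - a) * (d - c))%:E.
Proof.
move=> ab cd; rewrite /area product_measure1E//= !lebesgue_measure_itv/= !lte_fin.
have itvE (u v : R) : u <= v -> (if (u < v)%R then v%:E + (- u)%:E else 0)%E = (v - u)%:E.
  by rewrite le_eqVlt => /predU1P[->|->//]; rewrite ltxx subrr.
by rewrite !itvE// EFinM.
Qed.

(** The disc contains the square of side [r] with the same centre. *)
Lemma area_eball_ge x r : 0 < r -> ((r ^+ 2)%:E <= area R (eball x r))%E.
Proof.
move=> r0.
have -> : r ^+ 2 = ((x.1 + r / 2) - (x.1 - r / 2)) * ((x.2 + r / 2) - (x.2 - r / 2)).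
  by field.
rewrite -area_box; [|lra|lra].
apply: le_measure; rewrite ?inE.
- by apply: measurableX; exact: measurable_itv.
- exact: measurable_eball.
move=> [a b] [/= ]; rewrite !in_itv/= => ha hb; rewrite /eball/=.
apply: (le_lt_trans (enorm_le_sum _)) => /=; rewrite [ltRHS]splitr.
by apply: ltrD; rewrite ltr_distlC; lra.
Qed.

Lemma area_bounded D d x : D `<=` eball x d -> measurable (D : set plane) ->
  (area R D < +oo)%E.
Proof.
move=> Dd mD.
pose B : set plane := `](x.1 - `|d|), (x.1 + `|d|)[%classic `*`
  `](x.2 - `|d|), (x.2 + `|d|)[%classic.
apply: (@le_lt_trans _ _ (area R B)).
  apply: le_measure; rewrite ?inE//.
    by apply: measurableX; exact: measurable_itv.
  move=> y /Dd xyd; have {}xyd : enorm (x - y) < `|d|.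
    by apply: (lt_le_trans xyd); exact: ler_norm.
  split; rewrite /= in_itv/= -ltr_distlC.
    by apply: le_lt_trans xyd; exact: (normr_fst_enorm (x - y)).
  by apply: le_lt_trans xyd; exact: (normr_snd_enorm (x - y)).
have d0 := normr_ge0 d.
by rewrite area_box ?ltry; lra.
Qed.

Definition measure_density (k d : R) D A := forall x, A x ->
  forall r, 0 < r <= d -> ((k * r ^+ 2)%:E <= area R (eball x r `&` D))%E.

(** The homothety of centre [x] and ratio [r / d] maps a fixed disc contained in [C] into
    [C], by convexity, and into the disc of radius [r], because [d] bounds the distances
    in [D]. The image has area comparable to the square of [r]. *)
Lemma measure_density_convex C D d : open D -> 0 < d ->
    (forall x, D x -> D `<=` eball x d) ->
    open C -> convex_set C -> C `&` boundary D `<=` set0 ->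
  exists2 k, 0 < k & measure_density k d D (C `&` D).
Proof.
move=> oD d0 Dd oC cC Cb.
have [[z [Cz Dz]]|CD0] := pselect (C `&` D !=set0); last first.
  by exists 1 => // x CDx; exfalso; apply: CD0; exists x.
have CD : C `<=` D by apply: convex_sub_open => //; exists z.
have [eps eps0 epsC] := (open_enorm C).1 oC z Cz.
exists ((eps / d) ^+ 2); first by rewrite exprn_gt0// divr_gt0.
move=> x [Cx Dx] r /andP[r0 rd].
set rho := r / d.
have rho0 : 0 < rho by rewrite divr_gt0.
rewrite -exprMn mulrAC -mulrA -/rho.
have h := area_eball_ge (interp x z rho) (mulr_gt0 eps0 rho0).
apply: (le_trans h); apply: le_measure; rewrite ?inE.
- exact: measurable_eball.
- by apply: measurableI; [exact: measurable_eball|exact: open_measurable_plane].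
move=> y; rewrite /eball/= => hy.
(* [w] is the preimage of [y] under the homothety. *)
pose w : R * R := (x.1 + (y.1 - x.1) / rho, x.2 + (y.2 - x.2) / rho).
have rhoN0 : rho != 0 by rewrite gt_eqF.
have yw : y = interp x w rho.
  by case: y @w hy => y1 y2 w hy; rewrite /interp /w/=; congr pair; field.
have Cw : C w.
  apply: epsC; rewrite /eball/=.
  by move: hy; rewrite yw enorm_interp gtr0_norm// mulrC ltr_pM2r.
split; last first.
  rewrite yw; apply/CD/cC => //.
  by rewrite ltW//= ler_pdivrMr// mul1r.
have : enorm (x - w) < d by apply: Dd => //; exact: CD.
rewrite -(ltr_pM2l rho0) {2}/rho divfK ?gt_eqF// -[rho in X in X -> _]gtr0_norm//.
by rewrite -(enorm_interp x x) interpxx -yw.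
Qed.

Lemma open_side e : open [set x | 0 < side e x] /\ open [set x | side e x < 0].
Proof.
by split; apply/open_enorm => x /= sx;
  (have /side_stable[r r0 hr] : side e x != 0 by rewrite neq_lt sx ?orbT);
  exists r => // y /hr; first [rewrite (pmulr_rgt0 _ sx)|rewrite (nmulr_rgt0 _ sx)].
Qed.

Lemma convex_side e : convex_set [set x | 0 < side e x] /\
  convex_set [set x | side e x < 0].
Proof.
split=> x y t /= hx hy /andP[t0 t1]; rewrite side_interp.
  have [->|tN0] := eqVneq t 0; first by rewrite subr0 mul1r mul0r addr0.
  have {}t0 : 0 < t by rewrite lt_neqAle eq_sym tN0.
  apply: ltr_wpDl; last exact: mulr_gt0.
  by apply: mulr_ge0; [rewrite subr_ge0|exact: ltW].
have [->|tN0] := eqVneq t 0; first by rewrite subr0 mul1r mul0r addr0.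
have {}t0 : 0 < t by rewrite lt_neqAle eq_sym tN0.
apply: ltr_wnDl; last by rewrite pmulr_rlt0.
by apply: mulr_ge0_le0; [rewrite subr_ge0|exact: ltW].
Qed.

(** Induction over the lines: each of them splits the convex set [C] into two convex
    pieces, and once no line is left [C] does not meet the boundary of [D]. *)
Lemma measure_density_cells D d l : open D -> 0 < d ->
    (forall x, D x -> D `<=` eball x d) ->
  forall C, open C -> convex_set C ->
    (forall x, C x -> boundary D x -> exists2 e, e \in l & side e x = 0) ->
  exists2 k, 0 < k & measure_density k d D
    (C `&` D `&` [set x | forall e, e \in l -> side e x != 0]).
Proof.
move=> oD d0 Dd; elim: l => [|e l IH] C oC cC bC.
  have [|k k0 hk] := @measure_density_convex C D d oD d0 Dd oC cC.
    by move=> x [/bC/[apply]-[]].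
  by exists k => // x [CDx _]; exact: hk.
have [oP oN] := open_side e; have [cP cN] := convex_side e.
have side0 (S : set (R * R)) : (forall x, S x -> side e x != 0) ->
    forall x, (C `&` S) x -> boundary D x -> exists2 e, e \in l & side e x = 0.
  move=> hS x [Cx Sx] bx; have [e'] := bC x Cx bx.
  rewrite inE => /predU1P[->|e'l se']; last by exists e'.
  by move=> /eqP; rewrite (negbTE (hS _ Sx)).
have cI (A B : set (R * R)) : convex_set A -> convex_set B -> convex_set (A `&` B).
  by move=> cA cB x y t [? ?] [? ?] ?; split; [exact: cA|exact: cB].
have [k1 k10 hk1] := IH (C `&` _) (openI oC oP) (cI _ _ cC cP)
  (side0 _ (fun x h => lt0r_neq0 h)).
have [k2 k20 hk2] := IH (C `&` _) (openI oC oN) (cI _ _ cC cN)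
  (side0 _ (fun x h => ltr0_neq0 h)).
exists (Num.min k1 k2); first by rewrite lt_min k10.
move=> x [[Cx Dx] /= xl] r r0d.
have xl' e' : e' \in l -> side e' x != 0 by move=> e'l; apply: xl; rewrite inE e'l orbT.
have /orP[sx|sx] : (side e x < 0) || (0 < side e x).
  by rewrite -neq_lt; apply: xl; exact: mem_head.
- apply: le_trans (hk2 x _ r r0d) => //.
  by rewrite lee_fin ler_wpM2r ?sqr_ge0// ge_min lexx orbT.
- apply: le_trans (hk1 x _ r r0d) => //.
  by rewrite lee_fin ler_wpM2r ?sqr_ge0// ge_min lexx.
Qed.

(** The points of [D] off the lines are dense in the closure, and a disc of radius [r]
    contains the discs of radius [r / 2] centred near its centre. *)
Lemma measure_density_closure D d l : open D -> 0 < d ->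
    (forall x, D x -> D `<=` eball x d) ->
    (forall e, e \in l -> e.1 != e.2) ->
    (forall x, boundary D x -> exists2 e, e \in l & side e x = 0) ->
  exists2 k, 0 < k & measure_density k d D (closure D).
Proof.
move=> oD d0 Dd l0 bD.
have [||k k0 hk] := @measure_density_cells D d l oD d0 Dd setT openT.
- by [].
- by move=> x _ /bD.
exists (k / 4); first by rewrite divr_gt0.
move=> x cDx r /andP[r0 rd].
have r4 : 0 < r / 4 by rewrite divr_gt0.
have /closure_enorm/(_ _ r4)[y Dy xy] := cDx.
have [e e0 eD] := (open_enorm D).1 oD y Dy.
have me : 0 < Num.min e (r / 4) by rewrite lt_min e0.
have [z yz zl] := off_lines_dense y l0 me.
move: yz; rewrite lt_min => /andP[yze yzr].
have xz : enorm (x - z) < r / 2.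
  by apply: (le_lt_trans (enorm_tri y _ _)); lra.
have -> : k / 4 * r ^+ 2 = k * (r / 2) ^+ 2 by field.
apply: (le_trans (hk z _ (r / 2) _)).
- by split => //; split => //; exact: eD.
- by apply/andP; split; lra.
apply: le_measure; rewrite ?inE.
- by apply: measurableI; [exact: measurable_eball|exact: open_measurable_plane].
- by apply: measurableI; [exact: measurable_eball|exact: open_measurable_plane].
apply: setSI => w; rewrite /eball/= => zw.
by apply: (le_lt_trans (enorm_tri z _ _)); lra.
Qed.

End Density.

(** * Means of integrable functions *)

Section MeanValue.
Context d (T : measurableType d) (R : realType) (mu : {measure set T -> \bar R}).
Implicit Types (A B D : set T) (u w : T -> R).

Definition mean A u : R := (fine (mu A))^-1 * (\int[mu]_(x in A) u x)%R.

Lemma integrable_subr A u w : measurable A ->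
  mu.-integrable A (EFin \o u) -> mu.-integrable A (EFin \o w) ->
  mu.-integrable A (EFin \o (fun x => u x - w x)).
Proof. by move=> mA iu iw; exact: (integrableB mA iu iw). Qed.

Lemma integrable_cst_lty A c : measurable A -> (mu A < +oo)%E ->
  mu.-integrable A (EFin \o cst c).
Proof.
move=> mA Aoo; apply/integrableP; split; first exact/measurable_EFinP/measurable_cst.
rewrite (_ : (\int[mu]_(x in A) _)%E = (`|c|%:E * mu A)%E); last first.
  exact: (integral_cst mu mA (`|c|%:E)).
by rewrite lte_mul_pinfty// lee_fin.
Qed.

Lemma mean_subr A u c : measurable A -> (0 < mu A < +oo)%E ->
  mu.-integrable A (EFin \o u) ->
  ((fine (mu A) * `|mean A u - c|)%:E <= \int[mu]_(x in A) (`|u x - c|)%:E)%E.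
Proof.
move=> mA /andP[A0 Aoo] iu.
have fA : mu A \is a fin_num by rewrite ge0_fin_numE// ltW.
have f0 : 0 < fine (mu A) by rewrite fine_gt0// A0.
have ic := integrable_cst_lty c mA Aoo.
have -> : fine (mu A) * `|mean A u - c| = `|(\int[mu]_(x in A) (u x - c))%R|.
  rewrite RintegralB// Rintegral_cst// /mean -[X in X * _]gtr0_norm// -normrM.
  by rewrite mulrBr mulrA mulfV ?gt_eqF// mul1r [fine _ * c]mulrC.
rewrite EFin_normr_Rintegral//; last exact: integrable_subr.
apply: le_abse_integral => //.
apply: (measurable_int mu); exact: integrable_subr.
Qed.

Lemma mean_ae_eq A u w : measurable A -> measurable_fun A u -> measurable_fun A w ->
  {ae mu, forall x, A x -> u x = w x} -> mean A u = mean A w.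
Proof.
move=> mA mu' mw uw; rewrite /mean /Rintegral; congr (_ * fine _).
apply: ae_eq_integral => //; [exact/measurable_EFinP|exact/measurable_EFinP|].
by apply: filterS uw => x h /h ->.
Qed.

(** The bound holding only almost everywhere, the nonnegative function [c - u] is compared
    with its absolute value. *)
Lemma mean_le A u c : measurable A -> (0 < mu A < +oo)%E ->
  mu.-integrable A (EFin \o u) -> {ae mu, forall x, A x -> u x <= c} ->
  mean A u <= c.
Proof.
move=> mA /andP[A0 Aoo] iu uc.
have fA : mu A \is a fin_num by rewrite ge0_fin_numE// ltW.
have f0 : 0 < fine (mu A) by rewrite fine_gt0// A0.
rewrite /mean mulrC ler_pdivrMr// -Rintegral_cst//.
have ic := integrable_cst_lty c mA Aoo.
rewrite -subr_ge0 -RintegralB// /Rintegral.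
rewrite (ae_eq_integral (fun x => `|c - u x|%:E))//.
- by apply: fine_ge0; apply: integral_ge0 => x _; rewrite lee_fin.
- by apply: (measurable_int mu); exact: integrable_subr.
- apply/measurable_EFinP; apply: measurableT_comp => //; apply/measurable_EFinP.
  by apply: (measurable_int mu); exact: integrable_subr.
- by apply: filterS uc => x h /h ucx; rewrite ger0_norm ?subr_ge0.
Qed.

Lemma meanD A u w : measurable A ->
  mu.-integrable A (EFin \o u) -> mu.-integrable A (EFin \o w) ->
  mean A (fun x => u x + w x) = mean A u + mean A w.
Proof. by move=> mA iu iw; rewrite /mean RintegralD// mulrDr. Qed.

Lemma meanZ A u a : measurable A -> mu.-integrable A (EFin \o u) ->
  mean A (fun x => a * u x) = a * mean A u.
Proof. by move=> mA iu; rewrite /mean RintegralZl// mulrCA. Qed.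

End MeanValue.

Section AreaSFinite.
Variable R : realType.

HB.instance Definition _ := @isSFinite.Build _ _ R (area R)
  (@sfinite_measure_sigma_finite _ _ _ (area R) (sigma_finiteT (area R))).

Lemma ae_imp (P Q : R * R -> Prop) : (forall x, P x -> Q x) ->
  {ae area R, forall x, P x} -> {ae area R, forall x, Q x}.
Proof.
by move=> PQ; exact: (@filterS _ _ (ae_filter_ringOfSetsType (area R)) _ _ PQ).
Qed.

Lemma ae_and (P Q : R * R -> Prop) : {ae area R, forall x, P x} ->
  {ae area R, forall x, Q x} -> {ae area R, forall x, P x /\ Q x}.
Proof. exact: (@filterI _ _ (ae_filter_ringOfSetsType (area R))). Qed.

End AreaSFinite.

(** * The Gagliardo kernel *)

Section Kernel.
Variables (R : realType) (s p : R).
Hypothesis p1 : 1 < p.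
Hypothesis sp2 : 2 < s * p.
Local Notation plane := (measurableTypeR R * measurableTypeR R)%type.
Local Notation mu := (area R).
Local Notation q := (2 + s * p).
Implicit Types (x y : R * R) (A B D : set plane) (u w : R * R -> R).

Definition kern u x y : R := `|u x - u y| `^ p / enorm (x - y) `^ q.

Let p0 : 0 < p. Proof. by rewrite (lt_trans _ p1). Qed.

Lemma kern_ge0 u x y : 0 <= kern u x y.
Proof. by rewrite divr_ge0 ?powR_ge0. Qed.

(** Splitting at [t = lam] replaces Hölder's inequality in all the estimates below: the
    parameter is chosen at the end, at the cost of a factor 2. *)
Lemma young_powR (lam t : R) : 0 < lam -> 0 <= t -> t <= lam + lam `^ (1 - p) * t `^ p.
Proof.
move=> lam0 t0; have [tl|lt] := leP t lam.
  by rewrite (le_trans tl)// lerDl mulr_ge0 ?powR_ge0.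
have t00 : 0 < t by exact: lt_trans lt.
have h : lam `^ (p - 1) <= t `^ (p - 1).
  by rewrite ge0_ler_powR ?nnegrE ?subr_ge0 ?(ltW p1) ?(ltW lt)// ltW.
have E : lam `^ (1 - p) * lam `^ (p - 1) = 1.
  by rewrite -powRD ?(gt_eqF lam0) ?implybT// addrA subrK subrr powRr0.
rewrite -(mulr_powRB1 t0)// ler_wpDl ?(ltW lam0)// mulrCA.
by rewrite ler_peMr// -[leLHS]E; apply: ler_wpM2l => //; exact: powR_ge0.
Qed.

(** On the diagonal both sides of the comparison with the kernel vanish, which is where
    the convention that a quotient by 0 is 0 matters. *)
Lemma kern_bound u x y lam delta : 0 < lam -> enorm (x - y) <= delta ->
  `|u x - u y| <= lam + lam `^ (1 - p) * delta `^ q * kern u x y.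
Proof.
move=> lam0 xy; apply: (le_trans (young_powR lam0 (normr_ge0 _))).
rewrite lerD2l -mulrA ler_wpM2l ?powR_ge0//.
have [->|xNy] := eqVneq x y.
  rewrite subrr normr0 powR0 ?gt_eqF//; apply: mulr_ge0; first exact: powR_ge0.
  exact: kern_ge0.
have e0 : 0 < enorm (x - y).
  rewrite lt_neqAle enorm_ge0 andbT eq_sym; apply: contra xNy => /eqP/enorm_eq0.
  by move/eqP; rewrite subr_eq0.
rewrite /kern mulrCA ler_peMr ?powR_ge0// ler_pdivlMr ?powR_gt0// mul1r.
rewrite ge0_ler_powR ?nnegrE ?enorm_ge0//.
  by rewrite addr_ge0// (le_trans _ (ltW sp2)).
by apply: le_trans xy; exact: enorm_ge0.
Qed.

Lemma measurable_enorm : measurable_fun setT (fun x : plane => enorm x).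
Proof.
have -> : (fun x : plane => enorm x) = (fun x : plane => (x.1 ^+ 2 + x.2 ^+ 2) `^ 2^-1).
  by apply/funext => x; rewrite powR12_sqrt// addr_ge0 ?sqr_ge0.
apply: (measurableT_comp (measurable_powR _)).
by apply: measurable_funD; apply: measurable_funX;
  [exact: measurable_fst|exact: measurable_snd].
Qed.

Lemma measurable_kern D u : measurable D -> measurable_fun D u ->
  measurable_fun (D `*` D) (fun z : plane * plane => kern u z.1 z.2).
Proof.
move=> mD mu_; rewrite /kern.
have m1 : measurable_fun (D `*` D) (fun z : plane * plane => u z.1).
  apply: (measurable_comp mD _ mu_); first by move=> _ [z [? ?] <-].
  exact: measurable_funTS measurable_fst.
have m2 : measurable_fun (D `*` D) (fun z : plane * plane => u z.2).
  apply: (measurable_comp mD _ mu_); first by move=> _ [z [? ?] <-].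
  exact: measurable_funTS measurable_snd.
apply: measurable_funM.
  apply: (measurableT_comp (measurable_powR _)).
  by apply: measurableT_comp => //; exact: measurable_funB.
rewrite [X in measurable_fun _ X](_ : _ =
    (fun z : plane * plane => enorm (z.1.1 - z.2.1, z.1.2 - z.2.2) `^ (- q))).
  apply: measurable_funTS; apply: (measurableT_comp (measurable_powR _)).
  apply: (measurableT_comp measurable_enorm); apply: measurable_fun_pair.
    apply: measurable_funB; apply: measurableT_comp; 
      solve [exact: measurable_fst|exact: measurable_snd].
  apply: measurable_funB; apply: measurableT_comp; 
      solve [exact: measurable_fst|exact: measurable_snd].
by apply/funext => z; rewrite powRN.
Qed.

Lemma measurable_kern1 D u x : measurable D -> measurable_fun D u -> D x ->
  measurable_fun D (kern u x).
Proof.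
move=> mD mu_ Dx.
apply: (@measurable_comp _ _ _ _ _ _ (D `*` D) (fun z => kern u z.1 z.2) D
  (fun y : plane => (x, y))).
- exact: measurableX.
- by move=> _ [y Dy <-].
- exact: measurable_kern.
- exact: measurable_funTS (pair1_measurable x).
Qed.

Definition kern_integral D u x : \bar R := (\int[mu]_(y in D) (kern u x y)%:E)%E.

Lemma kern_integral_ge0 D u x : (0 <= kern_integral D u x)%E.
Proof. by apply: integral_ge0 => y _; rewrite lee_fin kern_ge0. Qed.

(** Tonelli's theorem. All estimates use this iterated form, with [kern_integral] as the
    inner integral. *)
Lemma gagliardo_iterated D u : measurable D -> measurable_fun D u ->
  measurable_fun D (@kern_integral D u) /\
  gagliardo s p D u = (\int[mu]_(x in D) kern_integral D u x)%E.
Proof.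
move=> mD mu_.
pose F := (fun z : plane * plane => (kern u z.1 z.2)%:E) \_ (D `*` D).
have mF : measurable_fun setT F.
  apply/(measurable_restrictT _ (measurableX mD mD)).
  by apply/measurable_EFinP; exact: measurable_kern.
have F0 z : (0 <= F z)%E.
  by rewrite /F patchE; case: ifPn => // _; rewrite lee_fin kern_ge0.
have FE : fubini_F mu F = (kern_integral D u) \_ D.
  apply/funext => x; rewrite /fubini_F /F !patchE; case: ifPn => xD.
    rewrite /kern_integral [RHS]integral_mkcond; apply: eq_integral => y _.
    by rewrite !patchE in_setX xD.
  by rewrite integral0_eq// => y _; rewrite patchE in_setX (negbTE xD).
have FT := @fubini_tonelli1 _ _ _ _ _ mu mu F mF F0.
split.
  apply/(measurable_restrictT _ mD); rewrite -FE.
  exact: (@measurable_fun_fubini_tonelli_F _ _ _ _ _ mu F mF F0).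
rewrite [RHS]integral_mkcond -FE -FT /gagliardo integral_mkcond.
exact: eq_measure_integral.
Qed.

End Kernel.

(** * Fractional Morrey estimate *)

Section Morrey.
Variables (R : realType) (s p : R).
Local Notation plane := (measurableTypeR R * measurableTypeR R)%type.
Local Notation mu := (area R).
Local Notation q := (2 + s * p).
Variables (D : set plane) (d k : R).
Hypothesis p1 : 1 < p.
Hypothesis sp2 : 2 < s * p.
Hypothesis mD : measurable D.
Hypothesis d0 : 0 < d.
Hypothesis k0 : 0 < k.
Hypothesis Dd : forall x, closure D x -> D `<=` eball x d.
Hypothesis dens : measure_density k d D (closure D).
Implicit Types (x y : R * R) (A B : set plane) (u w : R * R -> R) (r t : R).

Let p0 : 0 < p. Proof. exact: lt_trans p1. Qed.

Let q0 : 0 < q. Proof. by rewrite addr_gt0// (lt_trans _ sp2). Qed.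

Lemma area_domain_lty : (mu D < +oo)%E.
Proof.
have [[x Dx]|D0] := pselect (D !=set0).
  by apply: (@area_bounded _ D d x) => //; apply: Dd; exact: subset_closure.
suff -> : D = set0 by rewrite measure0.
by apply/seteqP; split => // x Dx; apply: D0; exists x.
Qed.

Definition disc x r : set plane := eball x r `&` D.

Lemma measurable_disc x r : measurable (disc x r).
Proof. by apply: measurableI => //; exact: measurable_eball. Qed.

Lemma disc_sub x r : disc x r `<=` D.
Proof. exact: subIsetr. Qed.

Lemma area_sub_lty A : measurable A -> A `<=` D -> (mu A < +oo)%E.
Proof.
by move=> mA AD; apply: le_lt_trans area_domain_lty; apply: le_measure; rewrite ?inE.
Qed.

Lemma area_disc_ge x r : closure D x -> 0 < r <= d -> k * r ^+ 2 <= fine (mu (disc x r)).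
Proof.
move=> cDx rd; rewrite -lee_fin fineK; first exact: dens.
rewrite ge0_fin_numE// area_sub_lty//; first exact: measurable_disc.
exact: disc_sub.
Qed.

Lemma area_disc x r : closure D x -> 0 < r <= d -> (0 < mu (disc x r) < +oo)%E.
Proof.
move=> cDx rd; apply/andP; split.
  apply: lt_le_trans (dens cDx rd); rewrite lte_fin mulr_gt0// exprn_gt0//.
  by case/andP: rd.
by apply: area_sub_lty; [exact: measurable_disc|exact: disc_sub].
Qed.

Lemma sobolev_integrable u : sobolev s p D u -> mu.-integrable D (EFin \o u).
Proof.
move=> [mu_ Lu _]; apply/integrableP; split; first exact/measurable_EFinP.
have mup : measurable_fun D (fun x => (`|u x| `^ p)%:E).
  apply/measurable_EFinP; apply: (measurableT_comp (measurable_powR _)).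
  exact: measurableT_comp.
apply: (@le_lt_trans _ _ (\int[mu]_(x in D) (1%:E + (`|u x| `^ p)%:E))%E).
  apply: ge0_le_integral => //.
  - by apply: measurableT_comp => //; exact/measurable_EFinP.
  - by apply: emeasurable_funD => //; exact: measurable_cst.
  move=> x _; rewrite /= -EFinD lee_fin.
  by have := young_powR p1 ltr01 (normr_ge0 (u x)); rewrite powR1 mul1r.
rewrite ge0_integralD//.
apply: lte_add_pinfty => //.
by rewrite (integral_cst mu mD 1%:E) mul1e; exact: area_domain_lty.
Qed.

Section Oscillation.
Variable u : R * R -> R.
Hypothesis mu_ : measurable_fun D u.
Hypothesis iu : mu.-integrable D (EFin \o u).

(** Integrate [kern_bound] in [y] over [B]. This pointwise version yields the equality of
    [u] and its trace almost everywhere; integrated once more, it compares two means. *)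
Lemma mean_pointwise x B delta lam : D x -> B `<=` D -> measurable B ->
    (0 < mu B < +oo)%E -> (forall y, B y -> enorm (x - y) <= delta) -> 0 < lam ->
  ((fine (mu B) * `|mean mu B u - u x|)%:E <= (lam * fine (mu B))%:E +
    (lam `^ (1 - p) * delta `^ q)%:E * kern_integral s p D u x)%E.
Proof.
move=> Dx BD mB B0 xB lam0.
have fB : mu B \is a fin_num by rewrite ge0_fin_numE//; case/andP: B0.
have iuB : mu.-integrable B (EFin \o u) by exact: integrableS iu.
apply: (le_trans (mean_subr (u x) mB B0 iuB)).
set c := lam `^ (1 - p) * delta `^ q.
have c0 : 0 <= c by rewrite mulr_ge0 ?powR_ge0.
have mk := measurable_kern1 s p mD mu_ Dx.
have mkB : measurable_fun B (fun y => (kern s p u x y)%:E).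
  by apply/measurable_EFinP; exact: measurable_funS mk.
apply: (@le_trans _ _ (\int[mu]_(y in B) (lam%:E + c%:E * (kern s p u x y)%:E))%E).
  apply: ge0_le_integral => //.
  - apply/measurable_EFinP; apply: measurableT_comp => //.
    by apply: measurable_funB => //; exact: measurable_funS mu_.
  - by apply: emeasurable_funD; [exact: measurable_cst|exact: measurable_funeM].
  move=> y By; rewrite -EFinM -EFinD lee_fin distrC.
  by apply: kern_bound => //; exact: xB.
rewrite ge0_integralD//; last first.
- exact: measurable_funeM.
- by move=> y _; rewrite -EFinM lee_fin mulr_ge0// kern_ge0.
- by move=> y _; rewrite lee_fin ltW.
rewrite (integral_cst mu mB lam%:E) [(lam * _)%:E]EFinM fineK// leeD2l//.
rewrite ge0_integralZl_EFin//; last by move=> y _; rewrite lee_fin kern_ge0.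
rewrite lee_wpmul2l ?lee_fin//; apply: ge0_subset_integral => //.
  exact/measurable_EFinP.
by move=> y _; rewrite lee_fin kern_ge0.
Qed.

(** Integrate [mean_pointwise] in [x] over [A]. *)
Lemma mean_mean A B delta lam : A `<=` D -> measurable A -> (0 < mu A < +oo)%E ->
    B `<=` D -> measurable B -> (0 < mu B < +oo)%E ->
    (forall x y, A x -> B y -> enorm (x - y) <= delta) -> 0 < lam ->
  ((fine (mu A) * fine (mu B) * `|mean mu A u - mean mu B u|)%:E <=
    (lam * (fine (mu A) * fine (mu B)))%:E +
    (lam `^ (1 - p) * delta `^ q)%:E * gagliardo s p D u)%E.
Proof.
move=> AD mA A0 BD mB B0 AB lam0.
have fA : mu A \is a fin_num by rewrite ge0_fin_numE//; case/andP: A0.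
have iuA : mu.-integrable A (EFin \o u) by exact: integrableS iu.
set m := mean mu B u; set b := fine (mu B).
have b0 : 0 <= b by exact: fine_ge0.
set c := lam `^ (1 - p) * delta `^ q.
have c0 : 0 <= c by rewrite mulr_ge0 ?powR_ge0.
have [mi ->] := gagliardo_iterated s p mD mu_.
have miA : measurable_fun A (kern_integral s p D u) by exact: measurable_funS mi.
have mum : measurable_fun A (fun x => (`|u x - m|)%:E).
  apply/measurable_EFinP; apply: measurableT_comp => //.
  by apply: measurable_funB => //; exact: measurable_funS mu_.
have -> : fine (mu A) * b * `|mean mu A u - m| = b * (fine (mu A) * `|mean mu A u - m|).
  by ring.
have -> : lam * (fine (mu A) * b) = (lam * b) * fine (mu A) by ring.
rewrite [(b * _)%:E]EFinM.
apply: (@le_trans _ _ (b%:E * \int[mu]_(x in A) (`|u x - m|)%:E)%E).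
  by rewrite lee_wpmul2l ?lee_fin//; exact: mean_subr.
rewrite -ge0_integralZl_EFin//.
apply: (@le_trans _ _ (\int[mu]_(x in A) ((lam * b)%:E + c%:E * kern_integral s p D u x))%E).
  apply: ge0_le_integral => //.
  - by move=> x _; rewrite -EFinM lee_fin mulr_ge0.
  - exact: measurable_funeM.
  - by apply: emeasurable_funD; [exact: measurable_cst|exact: measurable_funeM].
  move=> x Ax; rewrite -EFinM distrC; apply: mean_pointwise => //; first exact: AD.
  by move=> y By; exact: AB.
rewrite ge0_integralD//; last first.
- exact: measurable_funeM.
- by move=> y _; rewrite mule_ge0 ?lee_fin// kern_integral_ge0.
- by move=> y _; rewrite lee_fin mulr_ge0// ltW.
rewrite (integral_cst mu mA (lam * b)%:E) [(_ * fine (mu A))%:E]EFinM fineK//.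
rewrite leeD2l// ge0_integralZl_EFin//; last by move=> y _; exact: kern_integral_ge0.
rewrite lee_wpmul2l ?lee_fin//; apply: ge0_subset_integral => //.
by move=> y _; exact: kern_integral_ge0.
Qed.

(** The value of [lam] that balances the two terms of [mean_mean]. *)
Lemma mean_close A B delta lam G : A `<=` D -> measurable A -> (0 < mu A < +oo)%E ->
    B `<=` D -> measurable B -> (0 < mu B < +oo)%E ->
    (forall x y, A x -> B y -> enorm (x - y) <= delta) -> 0 < lam ->
    (gagliardo s p D u <= (G `^ p)%:E)%E ->
    delta `^ q * G `^ p <= lam `^ p * (fine (mu A) * fine (mu B)) ->
  `|mean mu A u - mean mu B u| <= 2 * lam.
Proof.
move=> AD mA A0 BD mB B0 AB lam0 uG GAB.
have := mean_mean AD mA A0 BD mB B0 AB lam0.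
have /andP[A00 Aoo] := A0; have /andP[B00 Boo] := B0.
have fA : 0 < fine (mu A) by rewrite fine_gt0// A00.
have fB : 0 < fine (mu B) by rewrite fine_gt0// B00.
set ab := fine (mu A) * fine (mu B); have ab0 : 0 < ab by exact: mulr_gt0.
have c0 : 0 <= lam `^ (1 - p) * delta `^ q by rewrite mulr_ge0 ?powR_ge0.
move=> h; rewrite -(ler_pM2l ab0) -lee_fin; apply: (le_trans h).
apply: (@le_trans _ _ ((lam * ab)%:E + (lam `^ (1 - p) * delta `^ q)%:E * (G `^ p)%:E)%E).
  by apply: leeD2l; apply: lee_wpmul2l => //; rewrite lee_fin.
rewrite -EFinM -EFinD lee_fin -mulrA.
have -> : ab * (2 * lam) = lam * ab + lam `^ (1 - p) * (lam `^ p * ab).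
  rewrite [in RHS]mulrA -powRD ?(gt_eqF lam0) ?implybT// subrK powRr1 ?ltW//.
  ring.
by rewrite lerD2l ler_wpM2l ?powR_ge0.
Qed.

(** The Hölder exponent in dimension 2; it is positive because [2 < s * p]. *)
Definition holder_exp : R := (s * p - 2) / p.

Lemma holder_exp_gt0 : 0 < holder_exp.
Proof. by rewrite divr_gt0// subr_gt0. Qed.

Definition disc_const : R := 2 * (4 `^ q / k ^+ 2) `^ p^-1.

Lemma disc_const_gt0 : 0 < disc_const.
Proof. by rewrite mulr_gt0// powR_gt0// divr_gt0 ?powR_gt0// exprn_gt0. Qed.

(** At scale [t] the two discs have area at least [k * t ^+ 2] and mutual distances at most
    [4 * t], so that [mean_close] applies with [lam] a multiple of [t `^ holder_exp]. *)
Lemma mean_disc_close x y r r' t G : closure D x -> closure D y -> 0 < t ->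
    t <= r <= d -> t <= r' <= d -> enorm (x - y) + r + r' <= 4 * t ->
    0 < G -> (gagliardo s p D u <= (G `^ p)%:E)%E ->
  `|mean mu (disc x r) u - mean mu (disc y r') u| <= disc_const * G * t `^ holder_exp.
Proof.
move=> cx cy t0 /andP[tr rd] /andP[tr' r'd] xy G0 uG.
have r0 : 0 < r by exact: lt_le_trans tr.
have r'0 : 0 < r' by exact: lt_le_trans tr'.
have hr : 0 < r <= d by rewrite r0.
have hr' : 0 < r' <= d by rewrite r'0.
set c := (4 `^ q / k ^+ 2) `^ p^-1.
have c0 : 0 < c by rewrite powR_gt0// divr_gt0 ?powR_gt0// exprn_gt0.
have -> : disc_const * G * t `^ holder_exp = 2 * (c * G * t `^ holder_exp).
  by rewrite /disc_const !mulrA.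
apply: (@mean_close _ _ (4 * t) _ G) => //.
- exact: disc_sub.
- exact: measurable_disc.
- exact: area_disc.
- exact: disc_sub.
- exact: measurable_disc.
- exact: area_disc.
- move=> a b [xa _] [yb _].
  apply: (le_trans (enorm_tri x _ _)); rewrite enormB.
  apply: le_trans xy; rewrite -addrA addrC -addrA.
  have := enorm_tri y x b; move: xa yb; rewrite /eball/=; lra.
- by rewrite !mulr_gt0// powR_gt0.
have e1 : (c * G * t `^ holder_exp) `^ p = 4 `^ q / k ^+ 2 * G `^ p * t `^ (s * p - 2).
  rewrite !powRM ?mulr_ge0 ?powR_ge0 ?(ltW c0) ?(ltW G0)//.
  rewrite -!powRrM mulVf ?gt_eqF// powRr1 ?divr_ge0 ?powR_ge0 ?sqr_ge0//.
  by rewrite /holder_exp divfK ?gt_eqF.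
(* The exponent splits as [q = (s * p - 2) + 4]; the last 4 matches the two areas. *)
have e2 : (4 * t) `^ q = 4 `^ q * t `^ (s * p - 2) * t ^+ 4.
  rewrite powRM ?ltW// -mulrA -powR_mulrn ?ltW// -powRD ?(gt_eqF t0) ?implybT//.
  by congr (_ * _ `^ _); ring.
rewrite e1 e2.
have h1 := area_disc_ge cx hr; have h2 := area_disc_ge cy hr'.
have h : k ^+ 2 * t ^+ 4 <= fine (mu (disc x r)) * fine (mu (disc y r')).
  have -> : k ^+ 2 * t ^+ 4 = (k * t ^+ 2) * (k * t ^+ 2) by ring.
  have kt0 : 0 <= k * t ^+ 2 by rewrite mulr_ge0 ?sqr_ge0// ltW.
  apply: (ler_pM kt0 kt0).
    apply: le_trans h1; rewrite ler_wpM2l ?(ltW k0)//.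
    by rewrite ler_sqr ?nnegrE ?(ltW t0) ?(ltW r0).
  apply: le_trans h2; rewrite ler_wpM2l ?(ltW k0)//.
  by rewrite ler_sqr ?nnegrE ?(ltW t0) ?(ltW r'0).
have -> : 4 `^ q * t `^ (s * p - 2) * t ^+ 4 * G `^ p =
   4 `^ q / k ^+ 2 * G `^ p * t `^ (s * p - 2) * (k ^+ 2 * t ^+ 4).
  by field; rewrite gt_eqF.
by rewrite ler_wpM2l// !mulr_ge0 ?powR_ge0// invr_ge0 sqr_ge0.
Qed.

(** The sum of the geometric series obtained by halving the radius. *)
Definition holder_const : R := disc_const / (1 - 2^-1 `^ holder_exp).

Lemma half_powR_lt1 : 2^-1 `^ holder_exp < 1.
Proof.
have h : 2^-1 < 1 :> R by rewrite invf_lt1// ltr1n.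
have := @gt0_ltr_powR R holder_exp holder_exp_gt0 2^-1 1; rewrite powR1.
by apply => //; rewrite nnegrE// invr_ge0.
Qed.

Lemma holder_const_gt0 : 0 < holder_const.
Proof. by rewrite divr_gt0 ?disc_const_gt0// subr_gt0 half_powR_lt1. Qed.

Lemma disc_const_le : disc_const <= holder_const.
Proof.
rewrite /holder_const ler_pdivlMr ?subr_gt0 ?half_powR_lt1//.
by rewrite ler_piMr ?(ltW disc_const_gt0)// lerBlDr lerDl powR_ge0.
Qed.

(** The radius is halved until it is within a factor 2 of [r']; each step costs
    [mean_disc_close], and the costs decrease geometrically. *)
Lemma mean_disc_radii x r r' G : closure D x -> 0 < r' <= r -> r <= d ->
    0 < G -> (gagliardo s p D u <= (G `^ p)%:E)%E ->
  `|mean mu (disc x r) u - mean mu (disc x r') u| <= holder_const * G * r `^ holder_exp.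
Proof.
move=> cx /andP[r'0 r'r] rd G0 uG.
have r0 : 0 < r by exact: lt_le_trans r'r.
suff h n : forall r, r <= d -> r' <= r -> r / 2 ^+ n.+1 <= r' ->
    `|mean mu (disc x r) u - mean mu (disc x r') u| <= holder_const * G * r `^ holder_exp.
  have [n hn] : exists n, r / 2 ^+ n.+1 <= r'.
    exists (Num.truncn (r / r')).
    rewrite ler_pdivrMr ?exprn_gt0// mulrC -ler_pdivrMr//.
    apply: (@le_trans _ _ (Num.truncn (r / r')).+1%:R).
      exact/ltW/truncnS_gt.
    rewrite -natrX ler_nat ltnW// -addn1 addnC.
    by apply: ltn_expl.
  exact: h hn.
have CG0 : 0 <= disc_const * G by rewrite mulr_ge0 ?(ltW G0)// ltW// disc_const_gt0.
have base r1 : r1 <= d -> r' <= r1 -> r1 / 2 <= r' ->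
    `|mean mu (disc x r1) u - mean mu (disc x r') u| <= disc_const * G * r1 `^ holder_exp.
  move=> r1d r'r1 r1r'; have r10 : 0 < r1 by exact: lt_le_trans r'r1.
  apply: (@le_trans _ _ (disc_const * G * (r1 / 2) `^ holder_exp)).
    apply: mean_disc_close => //; rewrite ?subrr ?enorm0; lra.
  rewrite ler_wpM2l//.
  by rewrite ge0_ler_powR ?nnegrE ?(ltW holder_exp_gt0)//; lra.
have C_le r1 : disc_const * G * r1 `^ holder_exp <= holder_const * G * r1 `^ holder_exp.
  by rewrite ler_wpM2r ?powR_ge0// ler_wpM2r ?(ltW G0)// disc_const_le.
elim: n => [|n IH] r1 r1d r'r1 h1.
  by apply: le_trans (C_le r1); apply: base => //; rewrite expr1 in h1.
have r10 : 0 < r1 by exact: lt_le_trans r'r1.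
have [hr|hr] := leP (r1 / 2) r'; first by apply: le_trans (C_le r1); exact: base.
have /IH : r1 / 2 <= d by lra.
move=> /(_ (ltW hr)); rewrite -mulrA -invfM -exprS => /(_ h1) IH1.
have b1 : `|mean mu (disc x r1) u - mean mu (disc x (r1 / 2)) u| <=
    disc_const * G * r1 `^ holder_exp.
  apply: (@le_trans _ _ (disc_const * G * (r1 / 2) `^ holder_exp)).
    apply: mean_disc_close => //; rewrite ?subrr ?enorm0; lra.
  rewrite ler_wpM2l//.
  by rewrite ge0_ler_powR ?nnegrE ?(ltW holder_exp_gt0)//; lra.
apply: (le_trans (ler_distD (mean mu (disc x (r1 / 2)) u) _ _)).
apply: (le_trans (lerD b1 IH1)).
rewrite powRM ?invr_ge0 ?(ltW r10)//.
have a1 : 0 < 1 - 2^-1 `^ holder_exp by rewrite subr_gt0 half_powR_lt1.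
rewrite /holder_const le_eqVlt; apply/orP; left; apply/eqP; field.
by rewrite gt_eqF.
Qed.

Lemma powR_small (a c e : R) : 0 < a -> 0 <= c -> 0 < e ->
  exists2 r0, 0 < r0 <= d & forall r, 0 < r <= r0 -> c * r `^ a < e.
Proof.
move=> a0 c0 e0; pose t := (e / (c + 1)) `^ a^-1.
have c1 : 0 < c + 1 by rewrite ltr_wpDl.
have t0 : 0 < t by rewrite powR_gt0// divr_gt0.
exists (Num.min d t); first by rewrite lt_min d0 t0 ge_min lexx.
move=> r /andP[r0]; rewrite le_min => /andP[_ rt].
have h : r `^ a <= e / (c + 1).
  apply: (@le_trans _ _ (t `^ a)).
    by rewrite ge0_ler_powR ?nnegrE ?(ltW a0) ?(ltW r0) ?(ltW t0).
  by rewrite -powRrM mulVf ?gt_eqF// powRr1// divr_ge0// ltW.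
apply: (@le_lt_trans _ _ (c * (e / (c + 1)))); first by rewrite ler_wpM2l.
by rewrite mulrA ltr_pdivrMr// mulrC ltr_pM2l// ltrDl.
Qed.

(** The constant [G] is kept positive, so that it can be used as a scale even when the
    seminorm vanishes. *)
Lemma gagliardo_root : (gagliardo s p D u < +oo)%E ->
  exists2 G, 0 < G & (gagliardo s p D u <= (G `^ p)%:E)%E.
Proof.
move=> uoo; have g0 : (0 <= gagliardo s p D u)%E.
  by apply: integral_ge0 => z _; rewrite lee_fin; exact: (kern_ge0 s p u z.1 z.2).
have fg : gagliardo s p D u \is a fin_num by rewrite ge0_fin_numE.
set g := fine (gagliardo s p D u); have g0' : 0 <= g by exact: fine_ge0.
exists (g `^ p^-1 + 1); first by rewrite ltr_wpDl ?powR_ge0.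
rewrite -(fineK fg) lee_fin -/g.
apply: (@le_trans _ _ ((g `^ p^-1) `^ p)).
  by rewrite -powRrM mulVf ?gt_eqF// powRr1.
by rewrite ge0_ler_powR ?nnegrE ?addr_ge0 ?powR_ge0 ?(ltW p0)// lerDl.
Qed.

Hypothesis uoo : (gagliardo s p D u < +oo)%E.

(** The limit defining the trace exists at every point of the closure, since the means form
    a Cauchy family. *)
Lemma cvg_trace x : closure D x ->
  mean mu (disc x r) u @[r --> 0^'+] --> trace D u x.
Proof.
move=> cx; have [G G0 uG] := gagliardo_root uoo.
apply: cauchy_cvg; apply: cauchy_exP => e e0.
have CG : 0 <= holder_const * G by rewrite mulr_ge0 ?(ltW G0)// ltW// holder_const_gt0.
have [r0 /andP[r00 r0d] hr] := powR_small holder_exp_gt0 CG e0.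
exists (mean mu (disc x r0) u).
change (\forall r \near (0:R)^'+, ball (mean mu (disc x r0) u) e (mean mu (disc x r) u)).
near=> r; rewrite /ball/=.
have r0' : 0 < r by near: r; exact: nbhs_right_gt.
have rr0 : r <= r0 by near: r; exact: nbhs_right_le.
apply: (le_lt_trans (mean_disc_radii cx _ r0d G0 uG)); first by rewrite r0'.
by apply: hr; rewrite r00 lexx.
Unshelve. all: by end_near. Qed.

Lemma trace_mean_disc x r G : closure D x -> 0 < r <= d ->
    0 < G -> (gagliardo s p D u <= (G `^ p)%:E)%E ->
  `|mean mu (disc x r) u - trace D u x| <= holder_const * G * r `^ holder_exp.
Proof.
move=> cx /andP[r0 rd] G0 uG; apply/ler_addgt0Pr => e e0.
have /cvgrPdist_lt/(_ _ e0) h := cvg_trace cx.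
near (0:R)^'+ => r'.
have r'0 : 0 < r' by near: r'; exact: nbhs_right_gt.
have r'r : r' <= r by near: r'; exact: nbhs_right_le.
apply: (le_trans (ler_distD (mean mu (disc x r') u) _ _)); apply: lerD.
  by apply: mean_disc_radii => //; rewrite r'0.
by apply: ltW; rewrite distrC; near: r'.
Unshelve. all: by end_near. Qed.

Lemma disc_full x : closure D x -> disc x d = D.
Proof. by move=> cx; apply/seteqP; split => y; [case|move=> Dy; split => //; exact: Dd]. Qed.

(** The disc of radius [d] centred at [x] contains [D], so that this is [trace_mean_disc]
    for the largest radius. *)
Lemma trace_mean x G : closure D x ->
    0 < G -> (gagliardo s p D u <= (G `^ p)%:E)%E ->
  `|mean mu D u - trace D u x| <= holder_const * G * d `^ holder_exp.
Proof.
move=> cx G0 uG; rewrite -{1}(disc_full cx).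
by apply: trace_mean_disc => //; rewrite d0 lexx.
Qed.

(** Compare both traces with the means over discs of radius [enorm (x - y)]. *)
Lemma trace_holder x y G : closure D x -> closure D y -> 0 < enorm (x - y) <= d ->
    0 < G -> (gagliardo s p D u <= (G `^ p)%:E)%E ->
  `|trace D u x - trace D u y| <=
    (2 * holder_const + disc_const) * G * enorm (x - y) `^ holder_exp.
Proof.
move=> cx cy xyd G0 uG; set t := enorm (x - y).
have /andP[t0 td] := xyd.
have ttd : t <= t <= d by rewrite lexx.
have t4 : enorm (x - y) + t + t <= 4 * t.
  by rewrite -/t -addrA -mulr2n -mulrS mulr_natl ler_wpMn2l ?(ltW t0).
have h1 := trace_mean_disc cx xyd G0 uG.
have h2 := trace_mean_disc cy xyd G0 uG.
have h3 := mean_disc_close cx cy t0 ttd ttd t4 G0 uG.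
apply: (le_trans (ler_distD (mean mu (disc x t) u) _ _)).
have h4 := ler_distD (mean mu (disc y t) u) (mean mu (disc x t) u) (trace D u y).
have -> : (2 * holder_const + disc_const) * G * t `^ holder_exp =
    holder_const * G * t `^ holder_exp +
    (disc_const * G * t `^ holder_exp + holder_const * G * t `^ holder_exp) by ring.
apply: lerD; first by rewrite distrC; exact: h1.
exact: (le_trans h4 (lerD h3 h2)).
Qed.

(** By Tonelli's theorem the inner integral of the kernel is finite for almost every [x];
    at such a point [mean_pointwise] shows that the means over small discs tend to [u x]. *)
Lemma trace_eq_ae : {ae mu, forall x, D x -> u x = trace D u x}.
Proof.
have [mi gE] := gagliardo_iterated s p mD mu_.
have ii : mu.-integrable D (kern_integral s p D u).
  apply/integrableP; split => //.
  under eq_integral do rewrite gee0_abs ?kern_integral_ge0//.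
  by rewrite -gE.
apply: filterS (integrable_ae mD ii) => x h Dx.
have cx : closure D x by exact: subset_closure.
have {}h := h Dx.
set I := fine (kern_integral s p D u x).
have I0 : 0 <= I by apply: fine_ge0; exact: kern_integral_ge0.
apply/eqP; rewrite -subr_eq0 -normr_le0; apply/ler_addgt0Pr => e e0.
rewrite add0r.
set lam := e / 3; have lam0 : 0 < lam by rewrite divr_gt0.
have [r0 /andP[r00 r0d] hr] := @powR_small (s * p) (lam `^ (1 - p) * I / k) lam
  (lt_trans (ltr0n _ 2) sp2) ltac:(by rewrite !mulr_ge0 ?powR_ge0// invr_ge0 ltW) lam0.
have /cvgrPdist_lt/(_ _ lam0) hc := cvg_trace cx.
near (0:R)^'+ => r.
have rgt0 : 0 < r by near: r; exact: nbhs_right_gt.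
have rr0 : r <= r0 by near: r; exact: nbhs_right_le.
have hl : `|trace D u x - mean mu (disc x r) u| < lam by near: r.
have rd : 0 < r <= d by rewrite rgt0 (le_trans rr0).
have dx : forall y, disc x r y -> enorm (x - y) <= r by move=> y [/ltW].
have := mean_pointwise Dx (@disc_sub x r) (measurable_disc x r) (area_disc cx rd) dx lam0.
set m := fine (mu (disc x r)); set M := mean mu (disc x r) u.
have hm : k * r ^+ 2 <= m by exact: area_disc_ge.
have kr0 : 0 < k * r ^+ 2 by rewrite mulr_gt0// exprn_gt0.
have m0 : 0 < m by exact: lt_le_trans hm.
rewrite -(fineK h) -/I -EFinM -EFinD lee_fin => hM.
have hu : `|M - u x| <= 2 * lam.
  rewrite -(ler_pM2l m0); apply: (le_trans hM).
  have -> : m * (2 * lam) = lam * m + lam * m by ring.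
  rewrite lerD2l; apply: (@le_trans _ _ (lam * (k * r ^+ 2))); last first.
    by rewrite ler_wpM2l// ltW.
  have /ltW := hr r ltac:(by rewrite rgt0).
  rewrite -(ler_pM2r kr0); apply: le_trans.
  have -> : r `^ q = r ^+ 2 * r `^ (s * p).
    by rewrite powRD ?(gt_eqF rgt0) ?implybT// powR_mulrn// ltW.
  rewrite le_eqVlt; apply/orP; left; apply/eqP; field; by rewrite gt_eqF.
apply: (le_trans (ler_distD M _ _)); rewrite distrC [X in _ + X]distrC.
apply: (le_trans (lerD hu (ltW hl))).
by rewrite /lam le_eqVlt; apply/orP; left; apply/eqP; field.
Unshelve. all: by end_near. Qed.

End Oscillation.
End Morrey.

(** * Traces and precise representatives *)

Section Continuity.
Variable R : realType.
Local Notation plane := (measurableTypeR R * measurableTypeR R)%type.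

(** Continuity relative to a set, in terms of the Euclidean norm. *)
Definition continuous_on (A : set (R * R)) (h : R * R -> R) := forall x, A x ->
  forall e, 0 < e -> exists2 r, 0 < r &
    forall y, A y -> enorm (x - y) < r -> `|h x - h y| < e.

Lemma continuous_on_measurable (D : set plane) (h : R * R -> R) :
  measurable D -> continuous_on D h -> measurable_fun D h.
Proof.
move=> mD ch; apply: (measurability _ (RGenOpens.measurableE R)).
move=> _ [_ [a [b ->] <-]].
(* [U] is the union of the discs on which continuity keeps [h] within bounds. *)
pose U : set plane := [set y | exists x r, [/\ 0 < r, enorm (x - y) < r &
  forall z, D z -> enorm (x - z) < r -> a < h z < b]].
have -> : D `&` h @^-1` `]a, b[%classic = D `&` U.
  apply/seteqP; split => [x [Dx] /=|x [Dx [y [r [r0 yx h0]]]]]; last first.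
    by split => //=; rewrite in_itv/=; exact: h0.
  rewrite in_itv/= => /andP[ax xb]; split => //.
  have [|r r0 hr] := ch x Dx (Num.min (h x - a) (b - h x)).
    by rewrite lt_min !subr_gt0 ax.
  exists x, r; split => //; first by rewrite subrr enorm0.
  move=> z Dz /(hr z Dz); rewrite lt_min !ltr_norml => /andP[/andP[? ?] /andP[? ?]].
  by apply/andP; split; lra.
apply: measurableI => //; apply: open_measurable_plane; apply/open_enorm.
move=> y [x [r [r0 xy h0]]]; exists (r - enorm (x - y)); first by rewrite subr_gt0.
move=> z yz; exists x, r; split => //.
by apply: (le_lt_trans (enorm_tri y _ _)); rewrite -ltrBrDl.
Qed.

End Continuity.

Section GagliardoClass.
Variables (R : realType) (s p : R).
Local Notation plane := (measurableTypeR R * measurableTypeR R)%type.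
Local Notation mu := (area R).
Implicit Types (D : set plane) (u w : R * R -> R).

Lemma gagliardo_ge0 D u : (0 <= gagliardo s p D u)%E.
Proof.
by apply: integral_ge0 => z _; rewrite lee_fin; exact: (kern_ge0 s p u z.1 z.2).
Qed.

Lemma gagliardo_ae_eq D u w : measurable D -> measurable_fun D u ->
    measurable_fun D w -> {ae mu, forall x, D x -> u x = w x} ->
  gagliardo s p D u = gagliardo s p D w.
Proof.
move=> mD mu_ mw uw.
have [mi ->] := gagliardo_iterated s p mD mu_; have [mj ->] := gagliardo_iterated s p mD mw.
apply: (ge0_ae_eq_integral mD mi mj).
- by move=> x _; exact: kern_integral_ge0.
- by move=> x _; exact: kern_integral_ge0.
apply: filterS (uw) => x h Dx; have {}h := h Dx.
apply: ge0_ae_eq_integral => //.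
- by apply/measurable_EFinP; exact: measurable_kern1.
- by apply/measurable_EFinP; exact: measurable_kern1.
- by move=> *; rewrite lee_fin kern_ge0.
- by move=> *; rewrite lee_fin kern_ge0.
by apply: filterS (uw) => y h' Dy; rewrite /kern h h'.
Qed.

Lemma gagliardoS D E u : measurable D -> measurable E -> measurable_fun E u ->
  D `<=` E -> (gagliardo s p D u <= gagliardo s p E u)%E.
Proof.
move=> mD mE mu_ DE; apply: ge0_subset_integral.
- exact: measurableX.
- exact: measurableX.
- by apply/measurable_EFinP; exact: (measurable_kern s p).
- by move=> z _; rewrite lee_fin; exact: (kern_ge0 s p u z.1 z.2).
by move=> z [/DE ? /DE ?].
Qed.

Lemma sobolevS D E u : measurable D -> measurable E -> D `<=` E ->
  sobolev s p E u -> sobolev s p D u.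
Proof.
move=> mD mE DE [mu_ Lu gu]; split.
- exact: measurable_funS mu_.
- apply: le_lt_trans Lu; apply: ge0_subset_integral => //.
  apply/measurable_EFinP; apply: (measurableT_comp (measurable_powR _)).
  exact: measurableT_comp.
- by apply: le_lt_trans gu; exact: gagliardoS.
Qed.

End GagliardoClass.

Section Trace.
Variables (R : realType) (s p : R).
Local Notation plane := (measurableTypeR R * measurableTypeR R)%type.
Local Notation mu := (area R).
Variables (D : set plane) (d k : R).
Hypothesis p1 : 1 < p.
Hypothesis sp2 : 2 < s * p.
Hypothesis mD : measurable D.
Hypothesis d0 : 0 < d.
Hypothesis k0 : 0 < k.
Hypothesis Dd : forall x, closure D x -> D `<=` eball x d.
Hypothesis dens : measure_density k d D (closure D).
Implicit Types (x y : R * R) (A B : set plane) (u w : R * R -> R) (r t : R).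

Local Notation W := (sobolev s p D).

Let p0 : 0 < p. Proof. exact: lt_trans p1. Qed.

Let Wi u (Wu : W u) : mu.-integrable D (EFin \o u) :=
  sobolev_integrable p1 mD Dd Wu.

Lemma disc_integrable u x r : W u -> mu.-integrable (disc D x r) (EFin \o u).
Proof.
move=> Wu; apply: integrableS (Wi Wu) => //; first exact: measurable_disc.
exact: disc_sub.
Qed.

Lemma sobolev_cvg_trace u x : W u -> closure D x ->
  mean mu (disc D x r) u @[r --> 0^'+] --> trace D u x.
Proof. move=> Wu cx; have [mu_ _ gu] := Wu.
exact: (cvg_trace p1 sp2 mD d0 k0 Dd dens mu_ (Wi Wu) gu cx). Qed.

Lemma trace_unique u x l :
  mean mu (disc D x r) u @[r --> 0^'+] --> l -> trace D u x = l.
Proof. by move=> /cvg_lim; apply. Qed.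

(** The trace depends on the class of [u] only. *)
Lemma trace_ae_eq u w x : measurable_fun D u -> measurable_fun D w ->
  {ae mu, forall y, D y -> u y = w y} -> trace D u x = trace D w x.
Proof.
move=> mu_ mw uw.
suff E : (fun r => mean mu (disc D x r) u) = (fun r => mean mu (disc D x r) w).
  by rewrite /trace; have := congr1 (fun f : R -> R => lim (f @ 0^'+)) E.
apply/funext => r; apply: mean_ae_eq.
- exact: measurable_disc.
- by apply: measurable_funS mu_ => //; exact: disc_sub.
- by apply: measurable_funS mw => //; exact: disc_sub.
- by apply: (ae_imp _ uw) => y h [_ /h].
Qed.

Lemma trace_le u x c : W u -> closure D x ->
  {ae mu, forall y, D y -> u y <= c} -> trace D u x <= c.
Proof.
move=> Wu cx uc; have h := sobolev_cvg_trace Wu cx.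
rewrite -(cvg_lim _ h)//; apply: limr_le; first by apply/cvg_ex; exists (trace D u x).
near=> r; apply: mean_le.
- exact: measurable_disc.
- apply: (area_disc mD k0 Dd dens) => //.
  by apply/andP; split; near: r; [exact: nbhs_right_gt|exact: nbhs_right_le].
- exact: disc_integrable.
- by apply: (ae_imp _ uc) => y h' [_ /h'].
Unshelve. all: by end_near. Qed.

Lemma trace_lin u w a b x : W u -> W w -> closure D x ->
  trace D (fun y => a * u y + b * w y) x = a * trace D u x + b * trace D w x.
Proof.
move=> Wu Ww cx; apply: trace_unique.
have -> : (fun r => mean mu (disc D x r) (fun y => a * u y + b * w y)) =
    (fun r => a * mean mu (disc D x r) u + b * mean mu (disc D x r) w).
  apply/funext => r; have mB : measurable (disc D x r) by exact: measurable_disc.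
  have iZ c v : W v -> mu.-integrable (disc D x r) (EFin \o (fun y => c * v y)).
    by move=> Wv; exact: (integrableZl mB c (disc_integrable _ _ Wv)).
  rewrite meanD//; [|exact: iZ..].
  by rewrite !meanZ//; exact: disc_integrable.
apply: cvgD; (apply: cvgM; [exact: cvg_cst|exact: sobolev_cvg_trace]).
Qed.

Lemma trace_continuous u : W u -> continuous_on (closure D) (trace D u).
Proof.
move=> Wu x cx e e0; have [mu_ _ gu] := Wu.
have [G G0 uG] := gagliardo_root p1 gu.
have C0 : 0 <= (2 * holder_const s p k + disc_const s p k) * G.
  have C1 := holder_const_gt0 p1 sp2 k0; have C2 := disc_const_gt0 s p k0.
  apply: mulr_ge0 (ltW G0); apply: addr_ge0 (ltW C2).
  by apply: mulr_ge0 (ltW C1).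
have [r /andP[r0 rd] hr] := powR_small d0 (holder_exp_gt0 p1 sp2) C0 e0.
exists r => // y cy xyr.
have [->|xNy] := eqVneq x y; first by rewrite subrr normr0.
have xy0 : 0 < enorm (x - y).
  rewrite lt_neqAle enorm_ge0 andbT eq_sym; apply: contra xNy => /eqP/enorm_eq0.
  by move/eqP; rewrite subr_eq0.
apply: le_lt_trans (hr _ _).
  apply: (trace_holder p1 sp2 mD d0 k0 Dd dens mu_ (Wi Wu) gu cx cy _ G0 uG).
  by rewrite xy0 (le_trans (ltW xyr)).
by rewrite xy0 ltW.
Qed.

Lemma continuous_onS A A' (h : R * R -> R) :
  A `<=` A' -> continuous_on A' h -> continuous_on A h.
Proof.
move=> AA' ch x /AA' Ax e e0; have [r r0 hr] := ch x Ax e e0.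
by exists r => // y /AA' Ay; exact: hr.
Qed.

Lemma trace_measurable u : W u -> measurable_fun D (trace D u).
Proof.
move=> Wu; apply: continuous_on_measurable => //.
by apply: continuous_onS (trace_continuous Wu); exact: subset_closure.
Qed.

(** The representative of a class that coincides with its trace on the whole closure. *)
Definition precise u := W u /\ forall x, closure D x -> trace D u x = u x.

Lemma trace_ae u : W u -> {ae mu, forall x, D x -> u x = trace D u x}.
Proof.
move=> Wu; have [mu_ _ gu] := Wu.
exact: (trace_eq_ae p1 sp2 mD d0 k0 Dd dens mu_ (Wi Wu) gu).
Qed.

Lemma sobolev_ae_eq u w : W u -> measurable_fun D w ->
  {ae mu, forall x, D x -> u x = w x} -> W w.
Proof.
move=> [mu_ Lu gu] mw uw; split; first exact: mw.
  rewrite -(@ge0_ae_eq_integral _ _ _ mu D (fun x => (`|u x| `^ p)%:E))//.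
  - apply/measurable_EFinP; apply: (measurableT_comp (measurable_powR _)).
    exact: measurableT_comp.
  - apply/measurable_EFinP; apply: (measurableT_comp (measurable_powR _)).
    exact: measurableT_comp.
  - by apply: (ae_imp _ uw) => x h /h ->.
by rewrite -(gagliardo_ae_eq s p mD mu_ mw uw).
Qed.

Lemma precise_trace u : W u -> precise (trace D u).
Proof.
move=> Wu; have mt := trace_measurable Wu; have ae := trace_ae Wu.
split; first exact: sobolev_ae_eq ae.
move=> x cx; apply/esym/trace_ae_eq => //.
by case: Wu.
Qed.

Lemma bounded_Lp u M : measurable_fun D u -> (forall x, D x -> `|u x| <= M) ->
  (\int[mu]_(x in D) (`|u x| `^ p)%:E < +oo)%E.
Proof.
move=> mu_ uM; apply: (@le_lt_trans _ _ (\int[mu]_(x in D) (cst ((`|M| `^ p)%:E) x))%E).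
  apply: ge0_le_integral => //.
  - apply/measurable_EFinP; apply: (measurableT_comp (measurable_powR _)).
    exact: measurableT_comp.
  move=> x Dx; rewrite lee_fin ge0_ler_powR ?nnegrE ?(ltW p0)//.
  by rewrite (le_trans (uM _ Dx))// ler_norm.
rewrite integral_cst// lte_mul_pinfty// ?lee_fin ?powR_ge0//.
exact: (area_domain_lty mD Dd).
Qed.

Definition osc_const : R := holder_const s p k * d `^ holder_exp s p.

Lemma osc_const_gt0 : 0 < osc_const.
Proof. by apply: mulr_gt0 (powR_gt0 _ d0); exact: holder_const_gt0. Qed.

(** The seminorm over [D * D] bounds the distance from [u] to a single constant, even
    across different components of [D], because it is nonlocal. *)
Lemma precise_osc u x G : precise u -> closure D x -> 0 < G ->
  (gagliardo s p D u <= (G `^ p)%:E)%E -> `|u x - mean mu D u| <= osc_const * G.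
Proof.
move=> [Wu tu] cx G0 uG; have [mu_ _ gu] := Wu.
rewrite distrC -(tu x cx) /osc_const mulrAC.
exact: (trace_mean p1 sp2 mD d0 k0 Dd dens mu_ (Wi Wu) gu cx G0 uG).
Qed.

Lemma precise_bounded u : precise u ->
  exists2 M, 0 < M & forall x, closure D x -> `|u x| <= M.
Proof.
move=> pu; have [[mu_ _ gu] _] := pu.
have [G G0 uG] := gagliardo_root p1 gu.
exists (osc_const * G + `|mean mu D u|).
  by rewrite ltr_pwDl// mulr_gt0// osc_const_gt0.
move=> x cx; rewrite -[u x](subrK (mean mu D u)).
by apply: (le_trans (ler_normD _ _)); rewrite lerD2r; exact: precise_osc.
Qed.

Lemma precise_continuous u : precise u -> continuous_on (closure D) u.
Proof.
move=> [Wu tu] x cx e e0; have [r r0 hr] := trace_continuous Wu cx e0.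
by exists r => // y cy xy; rewrite -!tu//; exact: hr.
Qed.

End Trace.

(** * Uniform convexity and lower semicontinuity *)

Section Clarkson.
Variable R : realType.
Implicit Types a b x y q p : R.

(** After division by [(x + y) `^ q], this is [t `^ q <= t] on the unit interval, used
    at two points of sum 1. *)
Lemma powR_superadd x y q : 1 <= q -> 0 <= x -> 0 <= y ->
  x `^ q + y `^ q <= (x + y) `^ q.
Proof.
move=> q1 x0 y0; have q0 : 0 < q by exact: lt_le_trans q1.
have [xy0|xy0] := eqVneq (x + y) 0.
  move/eqP: xy0; rewrite paddr_eq0// => /andP[/eqP -> /eqP ->].
  by rewrite addr0 powR0 ?gt_eqF// addr0.
have s0 : 0 < x + y by rewrite lt_neqAle eq_sym xy0 addr_ge0.
have h z : 0 <= z -> z <= x + y -> z `^ q <= z / (x + y) * (x + y) `^ q.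
  move=> z0 zxy; rewrite -{1}[z](divfK xy0) powRM ?divr_ge0 ?(ltW s0)//.
  rewrite ler_wpM2r ?powR_ge0//; have [->|zN0] := eqVneq z 0.
    by rewrite mul0r powR0 ?gt_eqF.
  rewrite ge1r_powR// divr_gt0 ?lt_neqAle ?(eq_sym 0) ?zN0 ?z0//=.
    by rewrite ler_pdivrMr// mul1r.
  by rewrite xy0 ltW.
have hx : x `^ q <= x / (x + y) * (x + y) `^ q by apply: h => //; rewrite lerDl.
have hy : y `^ q <= y / (x + y) * (x + y) `^ q by apply: h => //; rewrite lerDr.
apply: (le_trans (lerD hx hy)).
by rewrite -mulrDl -mulrDl divff// mul1r.
Qed.

Lemma powR_midpoint x y q : 1 <= q -> 0 <= x -> 0 <= y ->
  (2^-1 * x + 2^-1 * y) `^ q <= 2^-1 * x `^ q + 2^-1 * y `^ q.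
Proof.
move=> q1 x0 y0; rewrite {2 4}(_ : 2^-1 = 1 - 2^-1); last first.
  by rewrite {2}(splitr 1) div1r addrK.
by apply: (convex_powR q1 (Itv01 _ _)) => //=;
  rewrite ?inE/= ?in_itv/= ?x0 ?y0// ?invr_ge0// invf_le1 ?ler1n.
Qed.

(** With exponent [p / 2] applied to squares: superadditivity, the parallelogram identity,
    then convexity. *)
Lemma clarkson p a b : 2 <= p ->
  `|2^-1 * a + 2^-1 * b| `^ p + `|2^-1 * a + - 2^-1 * b| `^ p <=
  2^-1 * (`|a| `^ p + `|b| `^ p).
Proof.
move=> p2; have q1 : 1 <= p / 2 by rewrite ler_pdivlMr// mul1r.
have E z : `|z| `^ p = (z ^+ 2) `^ (p / 2).
  by rewrite -real_normK ?num_real// -powR_mulrn// -powRrM mulrC divfK.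
rewrite !E; apply: (le_trans (powR_superadd q1 (sqr_ge0 _) (sqr_ge0 _))).
rewrite mulrDr; apply: le_trans (powR_midpoint q1 (sqr_ge0 _) (sqr_ge0 _)).
by rewrite le_eqVlt; apply/orP; left; apply/eqP; congr (_ `^ _); field.
Qed.

End Clarkson.

Section Scalars.
Variable R : realType.

Lemma weighted_midpoint (a c gm gh gu gw fu fw bm bh bu bw : R) :
    0 <= a -> 0 <= c -> gm + gh <= 2^-1 * (gu + gw) -> bm + bh <= 2^-1 * (bu + bw) ->
  a * gm - (2^-1 * fu + 2^-1 * fw) + c * bm + (a * gh + c * bh) <=
  2^-1 * (a * gu - fu + c * bu + (a * gw - fw + c * bw)).
Proof.
move=> a0 c0 /(ler_wpM2l a0) hg /(ler_wpM2l c0) hb.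
by lra.
Qed.

Lemma half_le (a b c : R) : 2 * b <= a -> a <= b + c -> a / 2 <= c.
Proof. by lra. Qed.

Lemma midpoint_itv (a c g h : R) : g <= c <= h -> g <= a <= h ->
  g <= 2^-1 * a + 2^-1 * c <= h.
Proof. by move=> /andP[? ?] /andP[? ?]; apply/andP; split; lra. Qed.

Lemma between_bound (a g h M N : R) : g <= a <= h -> - N <= h <= N -> - M <= g <= M ->
  - (M + N) <= a <= M + N.
Proof. by move=> /andP[? ?] /andP[? ?] /andP[? ?]; apply/andP; split; lra. Qed.

Lemma energy_lower (a c g F : R) : 0 <= a -> 0 <= c -> `|g| <= F -> - F <= a - g + c.
Proof. by rewrite ler_norml => ? ? /andP[? ?]; lra. Qed.

Lemma midpoint_gap (j h ju jw m e : R) : j + h <= 2^-1 * (ju + jw) -> m <= j ->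
  ju <= m + e -> jw <= m + e -> h <= e.
Proof. by lra. Qed.

Lemma two_halves (a c g e h : R) : h < e / 2 -> a - g <= h -> g - a <= h ->
  `|c - g| <= h -> `|a - c| <= e.
Proof. by rewrite !ler_norml => ? ? ? /andP[? ?]; apply/andP; split; lra. Qed.

Lemma quarters (a1 a2 a3 a4 a5 a6 e M : R) : a1 <= a2 + e / 4 -> a5 <= a6 + e / 4 ->
  `|a3 - a4| <= e / 4 -> a2 - a4 + a6 <= M + e / 4 -> a1 - a3 + a5 <= M + e.
Proof. by rewrite ler_norml => ? ? /andP[? ?] ?; lra. Qed.

Lemma energy_upper (a1 a2 a3 a4 m c F : R) : a1 - a2 + a3 <= m + a4 -> `|a2| <= F ->
  0 <= a3 -> a4 <= c -> a1 <= m + c + F.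
Proof. by rewrite ler_norml => ? /andP[? ?] ? ?; lra. Qed.

Lemma cauchy_rate (a : nat -> R) (C : R) : 0 < C ->
  (forall n j, (n <= j)%N -> `|a n - a j| <= C / n.+1%:R) ->
  forall n, `|limn a - a n| <= C / n.+1%:R.
Proof.
move=> C0 ha n.
have ca : cvgn a.
  apply: cauchy_cvg; apply: cauchy_exP => e e0.
  have eC : 0 < e / C by rewrite divr_gt0.
  have [N _ /(_ N (leqnn N)) /= hN] := near_infty_natSinv_lt (PosNum eC).
  exists (a N); exists N => // j /= Nj; rewrite /ball/=.
  apply: (le_lt_trans (ha _ _ Nj)).
  by rewrite mulrC -ltr_pdivlMr.
rewrite distrC; apply/ler_addgt0Pr => e e0.
have /cvgrPdist_lt/(_ _ e0)[N _ hN] := ca.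
have := hN (maxn n N) (leq_maxr _ _) => h.
apply: (le_trans (ler_distD (a (maxn n N)) _ _)); apply: lerD.
  by apply: ha; exact: leq_maxl.
by rewrite distrC ltW.
Qed.

Lemma near_all_seq (T : eqType) (l : seq T) (P : T -> nat -> Prop) :
  (forall e, e \in l -> \forall n \near \oo, P e n) ->
  \forall n \near \oo, forall e, e \in l -> P e n.
Proof.
elim: l => [|e l IH] h; first exact: nearW.
have h1 := h e (mem_head _ _).
have h2 : \forall n \near \oo, forall e', e' \in l -> P e' n.
  by apply: IH => e' e'l; apply: h; rewrite inE e'l orbT.
near=> n => e'; rewrite inE => /predU1P[->|]; first by near: n.
by move: e'; near: n.
Unshelve. all: by end_near. Qed.

Lemma three_eps (a b c g e : R) : `|a - b| < e / 3 -> `|b - c| < e / 3 ->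
  `|g - c| < e / 3 -> `|a - g| < e.
Proof.
by rewrite !ltr_norml => /andP[? ?] /andP[? ?] /andP[? ?]; apply/andP; split; lra.
Qed.

Lemma continuous_norm_powR (p : R) : 0 < p -> continuous (fun t : R => `|t| `^ p).
Proof.
move=> p0 t; have [->|t0] := eqVneq t 0.
  apply/cvgrPdist_lt => e e0; have e1 : 0 < e `^ p^-1 by rewrite powR_gt0.
  apply/nbhs_ballP; exists (e `^ p^-1) => //= z; rewrite /ball/= sub0r normrN => ze.
  rewrite normr0 powR0 ?gt_eqF// sub0r normrN ger0_norm ?powR_ge0//.
  have -> : e = (e `^ p^-1) `^ p by rewrite -powRrM mulVf ?gt_eqF// powRr1// ltW.
  by rewrite gt0_ltr_powR ?nnegrE ?powR_ge0.
have t0' : 0 < `|t| by rewrite normr_gt0.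
apply: (@continuous_comp _ _ _ (fun t : R => `|t|) (fun z : R => z `^ p)).
  exact: norm_continuous.
apply: differentiable_continuous; apply/derivable1_diffP.
by apply: derivable_powR; rewrite in_itv/= andbT.
Qed.

End Scalars.

Section IntegralLemmas.
Context d (T : measurableType d) (R : realType) (mu : {measure set T -> \bar R}).
Implicit Types (D : set T) (h : T -> R).

Lemma integrable_ge0 D h : measurable D -> measurable_fun D h ->
  (forall x, D x -> 0 <= h x) -> (\int[mu]_(x in D) (h x)%:E < +oo)%E ->
  mu.-integrable D (EFin \o h).
Proof.
move=> mD mh h0 hoo; apply/integrableP; split; first exact/measurable_EFinP.
rewrite (eq_integral (fun x => (h x)%:E))// => x; rewrite inE => Dx /=.
by rewrite ger0_norm// h0.
Qed.

(** The pointwise inequality also dominates [h1] and [h2], so that their integrability is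
    part of the conclusion. *)
Lemma integral_convexity D (h1 h2 h3 h4 : T -> R) : measurable D ->
    measurable_fun D h1 -> measurable_fun D h2 ->
    (forall x, D x -> 0 <= h1 x) -> (forall x, D x -> 0 <= h2 x) ->
    (forall x, D x -> h1 x + h2 x <= 2^-1 * (h3 x + h4 x)) ->
    mu.-integrable D (EFin \o h3) -> mu.-integrable D (EFin \o h4) ->
  [/\ mu.-integrable D (EFin \o h1), mu.-integrable D (EFin \o h2) &
    \int[mu]_(x in D) h1 x + \int[mu]_(x in D) h2 x <=
    2^-1 * (\int[mu]_(x in D) h3 x + \int[mu]_(x in D) h4 x)].
Proof.
move=> mD m1 m2 h10 h20 h12 i3 i4.
have i34 : mu.-integrable D (EFin \o (fun x => 2^-1 * (h3 x + h4 x))).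
  have := integrableZl mD (2^-1) (integrableD mD i3 i4).
  by apply: (eq_integrable mD) => x _.
have le_i h : measurable_fun D h -> (forall x, D x -> 0 <= h x) ->
    (forall x, D x -> h x <= 2^-1 * (h3 x + h4 x)) -> mu.-integrable D (EFin \o h).
  move=> mh h0 hh; apply: (le_integrable mD _ _ i34); first exact/measurable_EFinP.
  move=> x Dx /=; rewrite lee_fin ger0_norm ?h0//.
  by apply: (le_trans (hh _ Dx)); exact: ler_norm.
have i1 : mu.-integrable D (EFin \o h1).
  apply: le_i => // x Dx; apply: le_trans (h12 x Dx).
  by rewrite lerDl h20.
have i2 : mu.-integrable D (EFin \o h2).
  apply: le_i => // x Dx; apply: le_trans (h12 x Dx).
  by rewrite lerDr h10.
split => //; rewrite -RintegralD// -RintegralD// -RintegralZl//; last first.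
  by have := integrableD mD i3 i4; apply: (eq_integrable mD) => x _.
apply: le_Rintegral => //.
by have := integrableD mD i1 i2; apply: (eq_integrable mD) => x _.
Qed.

(** Fatou's lemma as lower semicontinuity: a strict lower bound on the integral of the limit
    passes to the tail of the sequence. An infinite integral is allowed. *)
Lemma fatou_eventually D (h_ : nat -> T -> R) h (c : R) : measurable D ->
    (forall n, measurable_fun D (h_ n)) ->
    (forall n x, D x -> 0 <= h_ n x) ->
    (forall x, D x -> h_ n x @[n --> \oo] --> h x) ->
    (c%:E < \int[mu]_(x in D) (h x)%:E)%E ->
  exists N, forall n, (N <= n)%N -> (c%:E < \int[mu]_(x in D) (h_ n x)%:E)%E.
Proof.
move=> mD mh h0 hc ch.
have E : (\int[mu]_(x in D) (h x)%:E = \int[mu]_(x in D) limn_einf (fun n => (h_ n x)%:E))%E.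
  apply: eq_integral => x; rewrite inE => Dx.
  have hcE : (h_ n x)%:E @[n --> \oo] --> (h x)%:E.
    by apply/fine_cvgP; split; [exact: nearW|exact: hc].
  by have [-> _] := cvg_limn_einf_sup hcE.
have mhE n : measurable_fun D (fun x => (h_ n x)%:E) by exact/measurable_EFinP.
have h0E n x : D x -> (0 <= (h_ n x)%:E)%E by move=> Dx; rewrite lee_fin h0.
have hf := @fatou _ _ _ mu D mD _ mhE h0E.
rewrite -E in hf; have {hf}ch := lt_le_trans ch hf.
rewrite limn_einf_lim in ch; apply: contrapT => hN.
suff : (limn (einfs (fun n => \int[mu]_(x in D) (h_ n x)%:E)) <= c%:E)%E.
  by rewrite leNgt ch.
apply: lime_le; first exact: is_cvg_einfs.
apply: nearW => N; rewrite leNgt; apply/negP => cN; apply: hN; exists N => n Nn.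
apply: (lt_le_trans cN); apply: ereal_inf_lbound.
by exists n.
Qed.

End IntegralLemmas.

(** * Continuous functions along segments *)

Section Segments.
Variable R : realType.
Implicit Types (e : (R * R) * (R * R)) (t : R) (A : set (R * R)) (h : R * R -> R).

Lemma place_segment e t : 0 <= t <= 1 -> segment_set e (place e (t, 0)).
Proof. by move=> t01; exists t => //; rewrite /= in_itv. Qed.

Lemma enorm_place e t t' :
  enorm (place e (t, 0) - place e (t', 0)) = `|t - t'| * enorm (e.2 - e.1).
Proof. by rewrite -enormZ /enorm/=; congr Num.sqrt; ring. Qed.

Lemma continuous_on_segment A h e : segment_set e `<=` A -> continuous_on A h ->
  {within `[0, 1], continuous (fun t : R => h (place e (t, 0)))}.
Proof.
move=> eA ch; apply/subspace_continuousP => t; rewrite /= in_itv/= => t01.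
apply/cvgrPdist_lt => eps eps0.
have [r r0 hr] := ch _ (eA _ (place_segment e t01)) _ eps0.
apply/nbhs_ballP; exists (r / (enorm (e.2 - e.1) + 1)) => /=.
  by rewrite divr_gt0// ltr_wpDl// enorm_ge0.
move=> t'; rewrite /ball/= => tt'; rewrite in_itv/= => t'01.
apply: hr; first exact: eA (place_segment e t'01).
rewrite enorm_place; apply: (@le_lt_trans _ _ (`|t - t'| * (enorm (e.2 - e.1) + 1))).
  by rewrite ler_wpM2l// lerDl.
by rewrite -ltr_pdivlMr// ltr_wpDl// enorm_ge0.
Qed.

Lemma within_continuous_on A h : {within A, continuous h} -> continuous_on A h.
Proof.
move=> /subspace_continuousP ch x Ax e e0.
have /cvgrPdist_lt/(_ _ e0) := ch x Ax.
move=> /nbhs_ballP[r /= r0 hr]; exists r => // y Ay xy; apply: hr => //.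
split; first by apply: le_lt_trans xy; exact: (normr_fst_enorm (x - y)).
by apply: le_lt_trans xy; exact: (normr_snd_enorm (x - y)).
Qed.

End Segments.

(** * The obstacle problem *)

Section Energy.
Variables (R : realType) (s p : R).
Local Notation plane := (measurableTypeR R * measurableTypeR R)%type.
Local Notation mu := (area R).
Local Notation leb := (@lebesgue_measure R).
Local Notation I01 := (`[0%R, 1%R]%classic : set (measurableTypeR R)).
Variables (D : set plane) (d k : R).
Hypothesis p2 : 2 <= p.
Hypothesis sp2 : 2 < s * p.
Hypothesis mD : measurable D.
Hypothesis d0 : 0 < d.
Hypothesis k0 : 0 < k.
Hypothesis Dd : forall x, closure D x -> D `<=` eball x d.
Hypothesis dens : measure_density k d D (closure D).
Variable l : seq ((R * R) * (R * R)).
Hypothesis lD : forall e, e \in l -> segment_set e `<=` closure D.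
Variables (f b : R * R -> R) (delta : R).
Hypothesis fi : mu.-integrable D (EFin \o f).
Hypothesis cb : continuous_on (closure D) b.
Hypothesis b0 : forall x, closure D x -> 0 < b x.
Hypothesis delta0 : 0 < delta.
Variable e0 : (R * R) * (R * R).
Hypothesis e0l : e0 \in l.
Hypothesis e0N : e0.1 != e0.2.
Implicit Types (x y : R * R) (u w v : R * R -> R) (r t : R).

Let p1 : 1 < p. Proof. by rewrite (lt_le_trans _ p2)// ltr1n. Qed.
Let p0 : 0 < p. Proof. exact: lt_trans p1. Qed.

Local Notation W := (sobolev s p D).
Local Notation prec := (precise s p D).

Definition midpoint u w := fun x => 2^-1 * u x + 2^-1 * w x.
(** Written as a linear combination, like [midpoint], so that the same linearity lemmas
    apply to both. *)
Definition half_diff u w := fun x => 2^-1 * u x + - 2^-1 * w x.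

Lemma kern_clarkson u w x y :
  kern s p (midpoint u w) x y + kern s p (half_diff u w) x y <=
  2^-1 * (kern s p u x y + kern s p w x y).
Proof.
rewrite /kern -!mulrDl mulrA ler_wpM2r ?invr_ge0 ?powR_ge0//.
have -> : midpoint u w x - midpoint u w y = 2^-1 * (u x - u y) + 2^-1 * (w x - w y).
  by rewrite /midpoint; ring.
have -> : half_diff u w x - half_diff u w y = 2^-1 * (u x - u y) + - 2^-1 * (w x - w y).
  by rewrite /half_diff; ring.
exact: clarkson.
Qed.

Lemma kern_cvg (u_ : nat -> R * R -> R) u x y :
  u_ n x @[n --> \oo] --> u x -> u_ n y @[n --> \oo] --> u y ->
  kern s p (u_ n) x y @[n --> \oo] --> kern s p u x y.
Proof.
move=> hx hy; apply: cvgM; last exact: cvg_cst.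
apply: (@cvg_comp _ _ _ (fun n => u_ n x - u_ n y) (fun t : R => `|t| `^ p)).
  by apply: cvgB; [exact: hx|exact: hy].
exact: continuous_norm_powR.
Qed.

Definition gagliardoR u : R := fine (gagliardo s p D u).

Lemma gagliardo_fine u : W u -> gagliardo s p D u = (gagliardoR u)%:E.
Proof.
move=> [_ _ gu]; rewrite /gagliardoR fineK// ge0_fin_numE//; exact: gagliardo_ge0.
Qed.

Lemma gagliardoR_ge0 u : 0 <= gagliardoR u.
Proof. by apply: fine_ge0; exact: gagliardo_ge0. Qed.

Lemma measurable_lin u w (a c : R) : measurable_fun D u -> measurable_fun D w ->
  measurable_fun D (fun x => a * u x + c * w x).
Proof.
by move=> mu_ mw; apply: measurable_funD; apply: measurable_funM => //;
  exact: measurable_cst.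
Qed.

(** Integrate [kern_clarkson] over [D * D]. *)
Lemma gagliardo_clarkson u w : W u -> W w ->
  [/\ (gagliardo s p D (midpoint u w) < +oo)%E,
      (gagliardo s p D (half_diff u w) < +oo)%E &
      gagliardoR (midpoint u w) + gagliardoR (half_diff u w) <=
      2^-1 * (gagliardoR u + gagliardoR w)].
Proof.
move=> [mu_ _ gu] [mw _ gw].
have mm : measurable_fun D (midpoint u w) by exact: measurable_lin.
have mh : measurable_fun D (half_diff u w) by exact: measurable_lin.
have mDD : measurable (D `*` D) by exact: measurableX.
have mk v : measurable_fun D v ->
    measurable_fun (D `*` D) (fun z => kern s p v z.1 z.2).
  exact: measurable_kern.
have k_ge0 v z : (D `*` D) z -> 0 <= kern s p v z.1 z.2 by move=> _; exact: kern_ge0.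
have iu := integrable_ge0 mDD (mk _ mu_) (k_ge0 u) gu.
have iw := integrable_ge0 mDD (mk _ mw) (k_ge0 w) gw.
have [i1 i2 h] := integral_convexity mDD (mk _ mm) (mk _ mh) (k_ge0 _) (k_ge0 _)
  (fun z _ => kern_clarkson u w z.1 z.2) iu iw.
split; last exact: h.
  by have := integrable_lty mDD i1.
by have := integrable_lty mDD i2.
Qed.

(** The p-integrability comes for free: precise functions are bounded on the bounded
    set [D]. *)
Lemma precise_lin u w (a c : R) : prec u -> prec w ->
    (gagliardo s p D (fun x => (a * u x + c * w x)%R) < +oo)%E ->
  prec (fun x => a * u x + c * w x).
Proof.
move=> pu pw g; have [Wu tu] := pu; have [Ww tw] := pw.
have [mu_ _ _] := Wu; have [mw _ _] := Ww.
have [M M0 hM] := precise_bounded p1 sp2 mD d0 k0 Dd dens pu.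
have [N N0 hN] := precise_bounded p1 sp2 mD d0 k0 Dd dens pw.
split.
  split => //; first exact: measurable_lin.
  apply: (bounded_Lp p1 mD Dd (M := `|a| * M + `|c| * N)) => [|x Dx].
    exact: measurable_lin.
  rewrite (le_trans (ler_normD _ _))// !normrM lerD// ler_wpM2l//.
    by apply: hM; exact: subset_closure.
  by apply: hN; exact: subset_closure.
move=> x cx; rewrite (trace_lin p1 sp2 mD d0 k0 Dd dens)//.
by rewrite tu// tw.
Qed.

Lemma precise_midpoint u w : prec u -> prec w -> prec (midpoint u w) /\ prec (half_diff u w).
Proof.
move=> pu pw; have [g1 g2 _] := gagliardo_clarkson pu.1 pw.1.
split; [exact: (@precise_lin u w (2^-1) (2^-1) pu pw g1)|
  exact: (@precise_lin u w (2^-1) (- 2^-1) pu pw g2)].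
Qed.

Definition edge_density u e t : R := b (place e (t, 0)) * `|u (place e (t, 0))| `^ p.

Definition boundaryR u : R :=
  \sum_(e <- l) enorm (e.2 - e.1) * (\int[leb]_(t in `[0%R, 1%R]) edge_density u e t)%R.

Lemma measurable_on_segment h e : e \in l -> continuous_on (closure D) h ->
  measurable_fun I01 (fun t => h (place e (t, 0))).
Proof.
move=> el ch; apply: subspace_continuous_measurable_fun; first exact: measurable_itv.
exact: continuous_on_segment (lD el) ch.
Qed.

Lemma place_closure e t : e \in l -> `[0%R, 1%R]%classic t -> closure D (place e (t, 0)).
Proof. by move=> el; rewrite /= in_itv => t01; exact/(lD el)/place_segment. Qed.

Lemma edge_density_measurable u e : e \in l -> prec u -> measurable_fun I01 (edge_density u e).
Proof.
move=> el pu; apply: measurable_funM; first exact: measurable_on_segment.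
apply: (measurableT_comp (measurable_powR _)); apply: measurableT_comp => //.
apply: measurable_on_segment => //.
exact: (precise_continuous p1 sp2 mD d0 k0 Dd dens).
Qed.

Lemma edge_density_ge0 u e t : e \in l -> `[0%R, 1%R]%classic t -> 0 <= edge_density u e t.
Proof.
by move=> el t01; rewrite mulr_ge0 ?powR_ge0// ltW// b0//; exact: place_closure.
Qed.

Lemma leb01 : leb I01 = 1%E.
Proof. by rewrite lebesgue_measure_itv/= lte_fin ltr01 oppr0 adde0. Qed.

Lemma edge_density_integrable u e : e \in l -> prec u ->
  leb.-integrable `[0%R, 1%R] (EFin \o edge_density u e).
Proof.
move=> el pu; have [M M0 hM] := precise_bounded p1 sp2 mD d0 k0 Dd dens pu.
have [c c01 hc] := EVT_max ler01 (continuous_on_segment (lD el) cb).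
have i1 : leb.-integrable `[0%R, 1%R] (EFin \o cst (b (place e (c, 0)) * M `^ p)).
  by apply: integrable_cst_lty; [exact: measurable_itv|rewrite /= leb01 ltry].
apply: le_integrable i1; [exact: measurable_itv| |].
  by apply/measurable_EFinP; exact: edge_density_measurable el pu.
move=> t t01; rewrite /= lee_fin ger0_norm ?edge_density_ge0//.
apply: (le_trans _ (ler_norm _)); rewrite /edge_density.
apply: ler_pM; [by rewrite ltW// b0//; exact: place_closure|exact: powR_ge0| |].
  exact: hc.
rewrite ge0_ler_powR ?nnegrE ?(ltW p0) ?(ltW M0)//.
by apply: hM; exact: place_closure.
Qed.

Lemma arclength_boundaryR u : prec u ->
  arclength_integral l (fun x => b x * `|trace D u x| `^ p) = (boundaryR u)%:E.
Proof.
move=> pu; rewrite /arclength_integral /boundaryR -sumEFin big_seq [RHS]big_seq.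
apply: eq_bigr => e el; rewrite EFinM; congr (_ * _)%E.
rewrite /Rintegral fineK; last first.
  by apply: integrable_fin_num; [exact: measurable_itv|exact: edge_density_integrable].
apply: eq_integral => t; rewrite inE => t01; rewrite /edge_density pu.2//.
exact: place_closure.
Qed.

Lemma boundaryR_ge0 u : 0 <= boundaryR u.
Proof.
rewrite /boundaryR big_seq; apply: sumr_ge0 => e el; rewrite mulr_ge0 ?enorm_ge0//.
by apply: Rintegral_ge0 => t; exact: edge_density_ge0.
Qed.

Lemma boundaryR_clarkson u w : prec u -> prec w ->
  boundaryR (midpoint u w) + boundaryR (half_diff u w) <= 2^-1 * (boundaryR u + boundaryR w).
Proof.
move=> pu pw; have [pm ph] := precise_midpoint pu pw.
rewrite /boundaryR -!big_split/= mulr_sumr big_seq [leRHS]big_seq; apply: ler_sum => e el.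
rewrite -!mulrDr mulrCA; apply: ler_wpM2l; first exact: enorm_ge0.
have [|||_ _ h] := @integral_convexity _ _ _ leb I01
  (edge_density (midpoint u w) e) (edge_density (half_diff u w) e)
  (edge_density u e) (edge_density w e) (measurable_itv _)
  (edge_density_measurable el pm) (edge_density_measurable el ph)
  (fun t => edge_density_ge0 _ el)
  (fun t => edge_density_ge0 _ el); last by [].
- move=> t t01; rewrite /edge_density -!mulrDr mulrCA; apply: ler_wpM2l.
    by rewrite ltW// b0//; exact: place_closure.
  exact: clarkson.
- exact: edge_density_integrable.
- exact: edge_density_integrable.
Qed.

(** One side with distinct end points is enough: [b] has a positive minimum on it, by
    compactness. *)
Lemma boundaryR_lower : exists2 beta, 0 < beta & forall u c, prec u -> 0 <= c ->
  (forall x, closure D x -> c <= `|u x|) -> beta * c `^ p <= boundaryR u.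
Proof.
have [c c01 hc] := EVT_min ler01 (continuous_on_segment (lD e0l) cb).
have len0 : 0 < enorm (e0.2 - e0.1).
  rewrite lt_neqAle enorm_ge0 andbT eq_sym; apply: contra e0N => /eqP/enorm_eq0.
  by move/eqP; rewrite subr_eq0 eq_sym.
have bc : 0 < b (place e0 (c, 0)) by apply: b0; exact: (place_closure e0l).
exists (enorm (e0.2 - e0.1) * b (place e0 (c, 0))); first exact: mulr_gt0.
move=> u a pu a0 ua.
apply: (@le_trans _ _
  (enorm (e0.2 - e0.1) * (\int[leb]_(t in `[0%R, 1%R]) edge_density u e0 t)%R)).
  rewrite -mulrA ler_wpM2l ?enorm_ge0//.
  have -> : b (place e0 (c, 0)) * a `^ p =
      (\int[leb]_(t in I01) (cst (b (place e0 (c, 0)) * a `^ p) t))%R.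
    have mI : measurable I01 by exact: measurable_itv.
    by rewrite (Rintegral_cst leb mI) (_ : fine _ = 1) ?mulr1//; exact: (congr1 fine leb01).
  apply: le_Rintegral; [exact: measurable_itv| |exact: edge_density_integrable|].
    by apply: integrable_cst_lty; [exact: measurable_itv|rewrite /= leb01 ltry].
  move=> t t01; rewrite /= /edge_density.
  apply: ler_pM; [exact: ltW|exact: powR_ge0|exact: hc|].
  rewrite ge0_ler_powR ?nnegrE ?(ltW p0)//.
  by apply: ua; exact: place_closure.
rewrite /boundaryR (big_rem e0)//= lerDl big_seq; apply: sumr_ge0 => e /mem_rem el.
by rewrite mulr_ge0 ?enorm_ge0//; apply: Rintegral_ge0 => t; exact: edge_density_ge0.
Qed.

Lemma f_integrable u M : measurable_fun D u -> (forall x, D x -> `|u x| <= M) ->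
  mu.-integrable D (EFin \o (fun x => f x * u x)).
Proof.
move=> mu_ uM.
have i1 : mu.-integrable D (EFin \o (fun x => `|M| * `|f x|)).
  have := integrableZl mD (`|M|) (integrable_norm fi).
  by apply: (eq_integrable mD) => x _.
apply: (le_integrable mD _ _ i1).
  apply/measurable_EFinP/measurable_funM => //.
  by apply/measurable_EFinP; exact: measurable_int fi.
move=> x Dx; rewrite /= lee_fin normrM normrM !normr_id mulrC ler_wpM2r//.
by rewrite (le_trans (uM _ Dx))// ler_norm.
Qed.

Definition source u : R := (\int[mu]_(x in D) (f x * u x))%R.

Lemma precise_f_integrable u : prec u -> mu.-integrable D (EFin \o (fun x => f x * u x)).
Proof.
move=> pu; have [M M0 hM] := precise_bounded p1 sp2 mD d0 k0 Dd dens pu.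
have [[mu_ _ _] _] := pu.
by apply: (@f_integrable _ M) => // x Dx; apply: hM; exact: subset_closure.
Qed.

Lemma source_lin u w (a c : R) : prec u -> prec w ->
  source (fun x => a * u x + c * w x) = a * source u + c * source w.
Proof.
move=> pu pw; have iu := precise_f_integrable pu; have iw := precise_f_integrable pw.
rewrite /source -!RintegralZl// -RintegralD//; last 2 first.
- by have := integrableZl mD a iu; apply: (eq_integrable mD) => x _.
- by have := integrableZl mD c iw; apply: (eq_integrable mD) => x _.
by apply: eq_Rintegral => x _; ring.
Qed.

Lemma source_bound u M : prec u -> 0 <= M -> (forall x, D x -> `|u x| <= M) ->
  `|source u| <= M * (\int[mu]_(x in D) `|f x|)%R.
Proof.
move=> pu M0 uM; have iu := precise_f_integrable pu.
have inf_ : mu.-integrable D (EFin \o (fun x => `|f x|)).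
  by have := integrable_norm fi; apply: (eq_integrable mD).
apply: (le_trans (le_normr_Rintegral mD iu)); rewrite -RintegralZl//.
apply: le_Rintegral => //.
- by have := integrable_norm iu; apply: (eq_integrable mD).
- by have := integrableZl mD M inf_; apply: (eq_integrable mD) => x _.
by move=> x Dx; rewrite normrM mulrC ler_wpM2r// uM.
Qed.

Definition energyR u : R := p^-1 * gagliardoR u - source u + delta / p * boundaryR u.

Lemma energyE u : prec u -> energy s p D l f b delta u = (energyR u)%:E.
Proof.
move=> pu; rewrite /energy arclength_boundaryR// gagliardo_fine; last exact: pu.1.
rewrite -EFinM -EFinM.
have -> : (\int[mu]_(x in D) (f x * u x)%:E)%E = (source u)%:E.
  rewrite /source /Rintegral fineK//.
  by apply: integrable_fin_num => //; exact: precise_f_integrable.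
by rewrite -EFinN -!EFinD.
Qed.

(** Both integrals over [D] ignore null sets, and the trace of the trace is the trace. *)
Lemma energy_trace u : W u ->
  energy s p D l f b delta (trace D u) = energy s p D l f b delta u.
Proof.
move=> Wu; have ae := trace_ae p1 sp2 mD d0 k0 Dd dens Wu.
have mt := trace_measurable p1 sp2 mD d0 k0 Dd dens Wu.
have [mu_ _ _] := Wu.
rewrite /energy -(gagliardo_ae_eq s p mD mu_ mt ae).
have mf : measurable_fun D f by apply/measurable_EFinP; exact: measurable_int fi.
have -> : (\int[mu]_(x in D) (f x * trace D u x)%:E = \int[mu]_(x in D) (f x * u x)%:E)%E.
  apply: ae_eq_integral => //.
  - by apply/measurable_EFinP/measurable_funM.
  - by apply/measurable_EFinP/measurable_funM.
  - by apply: (ae_imp _ ae) => x h Dx; rewrite h.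
have E : trace D (trace D u) = trace D u.
  by apply/funext => x; apply/esym; exact: (trace_ae_eq mD x mu_ mt ae).
exact: (congr1 (fun h => (_ + _ * arclength_integral l (fun x => (b x * `|h x| `^ p)%R))%E) E).
Qed.

(** The linear term is affine along the segment from [u] to [w], so that Clarkson's
    inequality for the two other terms survives. *)
Lemma energyR_clarkson u w : prec u -> prec w ->
  energyR (midpoint u w) +
    (p^-1 * gagliardoR (half_diff u w) + delta / p * boundaryR (half_diff u w)) <=
  2^-1 * (energyR u + energyR w).
Proof.
move=> pu pw; have [_ _ hG] := gagliardo_clarkson pu.1 pw.1.
have hB := boundaryR_clarkson pu pw.
have hF : source (midpoint u w) = 2^-1 * source u + 2^-1 * source w by exact: source_lin.
have ip : 0 <= p^-1 by rewrite invr_ge0 ltW.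
have dp : 0 <= delta / p by rewrite divr_ge0// ltW.
rewrite /energyR hF; exact: weighted_midpoint.
Qed.

(** If the mean of [u] were much larger than [eps], then [u], whose oscillation is of order
    [eps], would be large on the whole boundary, against the bound on the boundary term. *)
Lemma precise_sup_bound : exists2 C, 0 < C & forall u eps, prec u -> 0 < eps ->
  gagliardoR u <= eps `^ p -> boundaryR u <= eps `^ p ->
  forall x, closure D x -> `|u x| <= C * eps.
Proof.
have [beta beta0 hb] := boundaryR_lower.
have C0 := osc_const_gt0 p1 sp2 d0 k0; set C := osc_const s p d k in C0.
pose c := 2 * C + 2 * (beta^-1) `^ p^-1 .
have c0 : 0 < c by rewrite addr_gt0// mulr_gt0// powR_gt0// invr_gt0.
exists (C + c) => [|u eps pu eps0 hG hB x cx]; first exact: addr_gt0.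
have gG : (gagliardo s p D u <= (eps `^ p)%:E)%E.
  by rewrite gagliardo_fine ?lee_fin//; exact: pu.1.
have hosc y (cy : closure D y) := precise_osc p1 sp2 mD d0 k0 Dd dens pu cy eps0 gG.
set a := mean mu D u in hosc.
suff ac : `|a| <= c * eps.
  rewrite -[u x](subrK a) (le_trans (ler_normD _ _))// mulrDl.
  by apply: lerD => //; exact: hosc.
rewrite leNgt; apply/negP => ca.
(* The mean then exceeds twice the oscillation, so that [u] is at least half of it. *)
have h2 : 2 * C * eps <= `|a|.
  apply: ltW; apply: le_lt_trans ca.
  by rewrite ler_wpM2r ?(ltW eps0)// lerDl mulr_ge0 ?powR_ge0.
have hu y : closure D y -> `|a| / 2 <= `|u y|.
  move=> cy; have h3 := hosc y cy; have h4 := ler_distD (u y) a 0.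
  rewrite subr0 [`|a - u y|]distrC subr0 in h4.
  have h5 : `|a| <= C * eps + `|u y| by apply: (le_trans h4); rewrite lerD2r.
  by apply: half_le h5; rewrite mulrA.
have a2 : 0 <= `|a| / 2 by rewrite divr_ge0.
have := hb u _ pu a2 hu; move=> /le_trans /(_ hB) h6.
have h7 : `|a| / 2 <= (beta^-1) `^ p^-1 * eps.
  have e1 : `|a| / 2 = ((`|a| / 2) `^ p) `^ p^-1 by rewrite -powRrM mulfV ?gt_eqF// powRr1.
  have e2 : (beta^-1) `^ p^-1 * eps = (beta^-1 * eps `^ p) `^ p^-1.
    by rewrite powRM ?invr_ge0 ?powR_ge0 ?(ltW beta0)// -powRrM mulfV ?gt_eqF// powRr1// ltW.
  rewrite e1 e2 ge0_ler_powR ?nnegrE ?invr_ge0 ?powR_ge0 ?(ltW p0)//.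
    by rewrite mulr_ge0 ?invr_ge0 ?powR_ge0// ltW.
  by rewrite ler_pdivlMl.
have h8 : `|a| <= 2 * (beta^-1) `^ p^-1 * eps.
  by rewrite -mulrA -ler_pdivrMl// mulrC.
move: ca; rewrite ltNge; apply/negP; rewrite negbK; apply: (le_trans h8).
by rewrite ler_wpM2r ?(ltW eps0)// lerDr mulr_ge0// ltW.
Qed.

(** An inequality holding almost everywhere passes to the precise representatives, at every
    point of the closure. *)
Lemma precise_le u w M x : prec u -> prec w ->
  {ae mu, forall y, D y -> u y - w y <= M} -> closure D x -> u x - w x <= M.
Proof.
move=> pu pw uw cx; have [_ [Wh th]] := precise_midpoint pu pw.
have E y : half_diff u w y = 2^-1 * (u y - w y) by rewrite /half_diff mulrBr mulNr.
have : trace D (half_diff u w) x <= 2^-1 * M.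
  apply: (trace_le p1 sp2 mD d0 k0 Dd dens Wh cx).
  by apply: (ae_imp _ uw) => y h Dy; rewrite E ler_pM2l ?invr_gt0//; exact: h.
by rewrite th// E ler_pM2l ?invr_gt0.
Qed.

Lemma precise_mono u w x : prec u -> prec w -> ae_le_on D u w ->
  closure D x -> u x <= w x.
Proof.
move=> pu pw uw cx; rewrite -subr_le0; apply: precise_le cx => //.
by apply: (ae_imp _ uw) => y h Dy; rewrite subr_le0; exact: h.
Qed.

Lemma gagliardo_fatou (u_ : nat -> R * R -> R) u (c : R) :
    (forall n, measurable_fun D (u_ n)) ->
    (forall x, D x -> u_ n x @[n --> \oo] --> u x) ->
    (c%:E < gagliardo s p D u)%E ->
  exists N, forall n, (N <= n)%N -> (c%:E < gagliardo s p D (u_ n))%E.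
Proof.
move=> mu_ cu; rewrite /gagliardo => cg.
have mDD : measurable (D `*` D) by exact: measurableX.
apply: (@fatou_eventually _ _ _ _ (D `*` D) (fun n z => kern s p (u_ n) z.1 z.2)
  (fun z => kern s p u z.1 z.2) c mDD _ _ _ cg).
- by move=> n; exact: (measurable_kern s p).
- by move=> n z _; exact: kern_ge0.
- by move=> z [z1 z2]; apply: kern_cvg; exact: cu.
Qed.

Variables phi1 phi2 : R * R -> R.
Hypothesis W1 : W phi1.
Hypothesis W2 : W phi2.

(** The obstacle constraint, stated pointwise between the precise representatives of the
    obstacles, so that it is stable under pointwise limits. *)
Definition admissible u := prec u /\
  forall x, closure D x -> trace D phi1 x <= u x <= trace D phi2 x.

Lemma obstacle_admissible u : obstacle_set s p D phi1 phi2 u -> admissible (trace D u).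
Proof.
move=> [Wu le1 le2].
have pt v : W v -> prec (trace D v) by exact: (precise_trace p1 sp2 mD d0 k0 Dd dens).
have ta v (Wv : W v) := trace_ae p1 sp2 mD d0 k0 Dd dens Wv.
split; first exact: pt.
move=> x cx; apply/andP; split.
  apply: precise_mono cx; [exact: pt|exact: pt|].
  apply: (ae_imp _ (ae_and le1 (ae_and (ta _ W1) (ta _ Wu)))) => y [h [h1 h2]] Dy.
  by rewrite -(h1 Dy) -(h2 Dy); exact: h.
apply: precise_mono cx; [exact: pt|exact: pt|].
apply: (ae_imp _ (ae_and le2 (ae_and (ta _ W2) (ta _ Wu)))) => y [h [h1 h2]] Dy.
by rewrite -(h1 Dy) -(h2 Dy); exact: h.
Qed.

Lemma admissible_obstacle u : admissible u -> obstacle_set s p D phi1 phi2 u.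
Proof.
move=> [[Wu _] hu].
have ta v (Wv : W v) := trace_ae p1 sp2 mD d0 k0 Dd dens Wv.
split => //.
  apply: (ae_imp _ (ta _ W1)) => x h Dx; rewrite h//.
  by have /andP[] := hu x (subset_closure Dx).
apply: (ae_imp _ (ta _ W2)) => x h Dx; rewrite h//.
by have /andP[] := hu x (subset_closure Dx).
Qed.

Lemma admissible_midpoint u w : admissible u -> admissible w -> admissible (midpoint u w).
Proof.
move=> [pu hu] [pw hw]; split; first by have [] := precise_midpoint pu pw.
move=> x cx; have := hu x cx; have := hw x cx; rewrite /midpoint.
move: (u x) (w x) (trace D phi1 x) (trace D phi2 x) => a c g h; exact: midpoint_itv.
Qed.

Lemma admissible_bounded : exists2 M, 0 < M &
  forall u, admissible u -> forall x, closure D x -> `|u x| <= M.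
Proof.
have pt v : W v -> prec (trace D v) by exact: (precise_trace p1 sp2 mD d0 k0 Dd dens).
have [M M0 hM] := precise_bounded p1 sp2 mD d0 k0 Dd dens (pt _ W1).
have [N N0 hN] := precise_bounded p1 sp2 mD d0 k0 Dd dens (pt _ W2).
exists (M + N) => [|u [_ hu] x cx]; first exact: addr_gt0.
have := hM x cx; have := hN x cx; have := hu x cx; rewrite !ler_norml.
move: (u x) (trace D phi1 x) (trace D phi2 x) => a g h; exact: between_bound.
Qed.

Lemma admissible_source_bounded :
  exists2 F, 0 <= F & forall u, admissible u -> `|source u| <= F.
Proof.
have [M M0 hM] := admissible_bounded.
exists (M * (\int[mu]_(x in D) `|f x|)%R).
  by rewrite mulr_ge0 ?(ltW M0)//; apply: Rintegral_ge0.
move=> u au; apply: source_bound; [exact: au.1|exact: ltW|].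
by move=> x Dx; apply: hM => //; exact: subset_closure.
Qed.

Section Infimum.
Let energies := [set energyR u | u in admissible].
Hypothesis adm0 : exists u, admissible u.

Lemma has_inf_energies : has_inf energies.
Proof.
split; first by have [u au] := adm0; exists (energyR u), u.
have [F F0 hF] := admissible_source_bounded; exists (- F) => _ [u au <-].
have hp : 0 <= p^-1 * gagliardoR u by rewrite mulr_ge0 ?gagliardoR_ge0// invr_ge0 ltW.
have hb : 0 <= delta / p * boundaryR u.
  by rewrite mulr_ge0 ?boundaryR_ge0// divr_ge0// ltW.
have := hF u au; rewrite /energyR; move: hp hb.
by move: (p^-1 * _) (delta / p * _) (source u) => a c g; exact: energy_lower.
Qed.

Let m := inf energies.

Lemma inf_le u : admissible u -> m <= energyR u.
Proof. by move=> au; apply: ge_inf; [exact: has_inf_energies.2|exists u]. Qed.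

Let c0 := Num.min p^-1 (delta / p).

Let c0_gt0 : 0 < c0.
Proof. by rewrite lt_min invr_gt0 p0 divr_gt0. Qed.

(** The midpoint being admissible, its energy is at least [m]; the defect in
    [energyR_clarkson] then bounds both terms of [half_diff u w]. The constant [c0] makes
    each of them at most [eta `^ p]. *)
Lemma near_minimizers : exists2 C, 0 < C &
  forall u w eta, admissible u -> admissible w -> 0 < eta ->
  energyR u <= m + c0 * eta `^ p -> energyR w <= m + c0 * eta `^ p ->
  forall x, closure D x -> `|u x - w x| <= C * eta.
Proof.
have [C C0 hC] := precise_sup_bound; exists (2 * C) => [|u w eta au aw eta0 hu hw x cx].
  by rewrite mulr_gt0.
have [pm ph] := precise_midpoint au.1 aw.1.
have hJ := energyR_clarkson au.1 aw.1; have hm := inf_le (admissible_midpoint au aw).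
have g0 : 0 <= gagliardoR (half_diff u w) by exact: gagliardoR_ge0.
have b0' : 0 <= boundaryR (half_diff u w) by exact: boundaryR_ge0.
have E : p^-1 * gagliardoR (half_diff u w) + delta / p * boundaryR (half_diff u w) <=
    c0 * eta `^ p.
  exact: midpoint_gap hJ hm hu hw.
have ip : 0 < p^-1 by rewrite invr_gt0.
have dp : 0 < delta / p by rewrite divr_gt0.
have e0' : 0 <= eta `^ p by exact: powR_ge0.
have hG : gagliardoR (half_diff u w) <= eta `^ p.
  rewrite -(ler_pM2l ip); apply: (@le_trans _ _ (c0 * eta `^ p)).
    by apply: le_trans E; rewrite lerDl mulr_ge0// ltW.
  by rewrite ler_wpM2r// ge_min lexx.
have hB : boundaryR (half_diff u w) <= eta `^ p.
  rewrite -(ler_pM2l dp); apply: (@le_trans _ _ (c0 * eta `^ p)).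
    by apply: le_trans E; rewrite lerDr mulr_ge0// ltW.
  by rewrite ler_wpM2r// ge_min lexx orbT.
have := hC _ _ ph eta0 hG hB x cx.
have -> : u x - w x = 2 * half_diff u w x.
  by rewrite /half_diff; move: (u x) (w x) => a c; field.
by rewrite normrM ger0_norm// -mulrA ler_pM2l.
Qed.

Lemma admissible_unique u w : admissible u -> admissible w ->
  energyR u <= m -> energyR w <= m ->
  forall x, closure D x -> u x = w x.
Proof.
move=> au aw hu hw x cx; have [C C0 hC] := near_minimizers.
apply/eqP; rewrite -subr_eq0 -normr_le0; apply/ler_addgt0Pr => e e0'; rewrite add0r.
have eC : 0 < e / C by rewrite divr_gt0.
have he : 0 <= c0 * (e / C) `^ p by rewrite mulr_ge0 ?powR_ge0// ltW.
have := hC u w (e / C) au aw eC.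
rewrite mulrCA mulfV ?gt_eqF// mulr1; apply => //.
  by apply: (le_trans hu); rewrite lerDl.
by apply: (le_trans hw); rewrite lerDl.
Qed.

Section Limit.
Variables (v_ : nat -> R * R -> R) (v : R * R -> R) (C : R).
Hypothesis C0 : 0 < C.
Hypothesis av : forall n, admissible (v_ n).
Hypothesis vv : forall n x, closure D x -> `|v x - v_ n x| <= C / n.+1%:R.

Let rate_small e : 0 < e -> \forall n \near \oo, C / n.+1%:R < e.
Proof.
move=> e0'; have eC : 0 < e / C by rewrite divr_gt0.
have := near_infty_natSinv_lt (PosNum eC); apply: filterS => n /=.
by rewrite ltr_pdivlMr// mulrC.
Qed.

Lemma limit_pointwise x : closure D x -> v_ n x @[n --> \oo] --> v x.
Proof.
move=> cx; apply/cvgrPdist_lt => e e0'; apply: filterS (rate_small e0') => n.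
by apply: le_lt_trans; exact: vv.
Qed.

Lemma limit_continuous : continuous_on (closure D) v.
Proof.
move=> x cx e e0'; have e3 : 0 < e / 3 by rewrite divr_gt0.
have [n _ /(_ n (leqnn n)) hn] := rate_small e3.
have [r r0 hr] := precise_continuous p1 sp2 mD d0 k0 Dd dens (av n).1 cx e3.
exists r => // y cy xy; have h1 := hr y cy xy.
have h2 := le_lt_trans (vv n cx) hn; have h3 := le_lt_trans (vv n cy) hn.
exact: three_eps h2 h1 h3.
Qed.

Lemma limit_measurable : measurable_fun D v.
Proof.
apply: continuous_on_measurable => //.
by apply: continuous_onS limit_continuous; exact: subset_closure.
Qed.

(** An infinite seminorm of the limit would make those of the sequence exceed [g]. *)
Lemma limit_gagliardo (g : R) : (forall n, gagliardoR (v_ n) <= g) ->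
  (gagliardo s p D v < +oo)%E.
Proof.
move=> hg; rewrite ltNge; apply/negP; rewrite leye_eq => /eqP voo.
have mv n : measurable_fun D (v_ n) by have [[[]]] := av n.
have cv x : D x -> v_ n x @[n --> \oo] --> v x.
  by move=> Dx; apply: limit_pointwise; exact: subset_closure.
have [N hN] : exists N, forall n, (N <= n)%N -> (g%:E < gagliardo s p D (v_ n))%E.
  by apply: gagliardo_fatou mv cv _; rewrite voo ltry.
have := hN N (leqnn N); rewrite gagliardo_fine; last exact: (av N).1.1.
by rewrite lte_fin ltNge hg.
Qed.

(** The limit is continuous on the closure, and its trace is squeezed between the functions
    [v_ n] up to the uniform error, so that the limit is precise. *)
Lemma limit_admissible (g : R) : (forall n, gagliardoR (v_ n) <= g) -> admissible v.
Proof.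
move=> hg; have gv := limit_gagliardo hg.
have bnd x : closure D x -> trace D phi1 x <= v x <= trace D phi2 x.
  move=> cx; have hv := limit_pointwise cx.
  have h n := (av n).2 x cx.
  apply/andP; split; rewrite -(cvg_lim _ hv)//.
    apply: limr_ge; first by apply/cvg_ex; exists (v x).
    by apply: nearW => n; have /andP[] := h n.
  apply: limr_le; first by apply/cvg_ex; exists (v x).
  by apply: nearW => n; have /andP[] := h n.
have Wv : W v.
  split => //; first exact: limit_measurable.
  have [M M0 hM] := precise_bounded p1 sp2 mD d0 k0 Dd dens (av 0%N).1.
  apply: (bounded_Lp p1 mD Dd (M := C + M)) => [|x Dx]; first exact: limit_measurable.
  have cx : closure D x by exact: subset_closure.
  rewrite -[v x](subrK (v_ 0%N x)) (le_trans (ler_normD _ _))// lerD//; last exact: hM.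
  by have := vv 0%N cx; rewrite divr1.
split => //; split => // x cx.
have pt := precise_trace p1 sp2 mD d0 k0 Dd dens Wv.
have tv := trace_ae p1 sp2 mD d0 k0 Dd dens Wv.
apply/eqP; rewrite -subr_eq0 -normr_le0; apply/ler_addgt0Pr => e e0'; rewrite add0r.
have e2 : 0 < e / 2 by rewrite divr_gt0.
have [n _ /(_ n (leqnn n)) hn] := rate_small e2.
have h1 : trace D v x - v_ n x <= C / n.+1%:R.
  apply: (precise_le pt (av n).1 _ cx); apply: (ae_imp _ tv) => y h Dy.
  by rewrite -(h Dy) (le_trans (ler_norm _))// vv//; exact: subset_closure.
have h2 : v_ n x - trace D v x <= C / n.+1%:R.
  apply: (precise_le (av n).1 pt _ cx); apply: (ae_imp _ tv) => y h Dy.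
  by rewrite -(h Dy) (le_trans (ler_norm _))// distrC vv//; exact: subset_closure.
have h3 := vv n cx; move: hn h1 h2 h3; move: (trace D v x) (v x) (v_ n x) => a c g'.
exact: two_halves.
Qed.

Lemma limit_source e : admissible v -> 0 < e ->
  \forall n \near \oo, `|source v - source (v_ n)| <= e.
Proof.
move=> adv e0'.
set F := (\int[mu]_(x in D) `|f x|)%R.
have F0 : 0 <= F by apply: Rintegral_ge0.
have eF : 0 < e / (F + 1) by rewrite divr_gt0// ltr_wpDl.
apply: filterS (rate_small eF) => n hn.
have [_ ph] := precise_midpoint adv.1 (av n).1.
have E : source (half_diff v (v_ n)) = 2^-1 * (source v - source (v_ n)).
  rewrite mulrBr -mulNr; exact: (source_lin (2^-1) (- 2^-1) adv.1 (av n).1).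
have M0 : 0 <= 2^-1 * (e / (F + 1)) by rewrite mulr_ge0 ?invr_ge0 ?(ltW eF).
have := source_bound ph M0; rewrite E normrM ger0_norm ?invr_ge0// -mulrA ler_pM2l ?invr_gt0//.
move=> h; apply: (le_trans (h _)) => [x Dx|].
  have -> : half_diff v (v_ n) x = 2^-1 * (v x - v_ n x) by rewrite /half_diff mulrBr mulNr.
  rewrite normrM ger0_norm ?invr_ge0// ler_pM2l ?invr_gt0//.
  apply: le_trans (ltW hn); apply: vv; exact: subset_closure.
by rewrite -mulrA ler_piMr ?(ltW e0')// ler_pdivrMl ?ltr_wpDl// mulr1 lerDl.
Qed.

Lemma limit_gagliardoR e : admissible v -> 0 < e ->
  \forall n \near \oo, gagliardoR v <= gagliardoR (v_ n) + e.
Proof.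
move=> adv e0'.
have mv n : measurable_fun D (v_ n) by have [[[]]] := av n.
have cv x : D x -> v_ n x @[n --> \oo] --> v x.
  by move=> Dx; apply: limit_pointwise; exact: subset_closure.
have cg : ((gagliardoR v - e)%:E < gagliardo s p D v)%E.
  by rewrite (gagliardo_fine adv.1.1) lte_fin ltrBlDr ltrDl.
have [N hN] := gagliardo_fatou mv cv cg.
exists N => // n /= Nn; have := hN n Nn.
by rewrite (gagliardo_fine (av n).1.1) lte_fin ltrBlDr => /ltW.
Qed.

Lemma limit_edge_density e0' e : e0' \in l -> admissible v -> 0 < e -> \forall n \near \oo,
  \int[leb]_(t in I01) edge_density v e0' t <=
  \int[leb]_(t in I01) edge_density (v_ n) e0' t + e.
Proof.
move=> el adv epos.
have fin u : admissible u -> (\int[leb]_(t in I01) (edge_density u e0' t)%:E)%E =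
    (\int[leb]_(t in I01) edge_density u e0' t)%:E.
  move=> au; rewrite /Rintegral fineK//; apply: integrable_fin_num.
    exact: measurable_itv.
  exact: edge_density_integrable el au.1.
have [N hN] : exists N, forall n, (N <= n)%N ->
    (((\int[leb]_(t in I01) edge_density v e0' t) - e)%:E <
      \int[leb]_(t in I01) (edge_density (v_ n) e0' t)%:E)%E.
  apply: (@fatou_eventually _ _ _ leb I01
    (fun n => edge_density (v_ n) e0') (edge_density v e0')).
  - exact: measurable_itv.
  - by move=> n; exact: edge_density_measurable el (av n).1.
  - by move=> n t; exact: edge_density_ge0.
  - move=> t t01; apply: cvgM; first exact: cvg_cst.
    apply: (@cvg_comp _ _ _ (fun n => v_ n (place e0' (t, 0))) (fun z : R => `|z| `^ p)).
      by apply: limit_pointwise; exact: place_closure.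
    exact: continuous_norm_powR.
  - by rewrite fin// lte_fin ltrBlDr ltrDl.
exists N => // n /= Nn; have := hN n Nn.
by rewrite fin// lte_fin ltrBlDr => /ltW.
Qed.

Lemma limit_boundaryR e : admissible v -> 0 < e ->
  \forall n \near \oo, boundaryR v <= boundaryR (v_ n) + e.
Proof.
move=> adv epos.
set L := \sum_(e' <- l) enorm (e'.2 - e'.1).
have L0 : 0 <= L by apply: sumr_ge0 => e' _; exact: enorm_ge0.
have eL : 0 < e / (L + 1) by rewrite divr_gt0// ltr_wpDl.
have := near_all_seq (fun e' el => limit_edge_density el adv eL).
apply: filterS => n hn.
apply: (@le_trans _ _ (boundaryR (v_ n) + L * (e / (L + 1)))); last first.
  rewrite lerD2l mulrCA ler_piMr ?(ltW epos)// ler_pdivrMr ?ltr_wpDl//.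
  by rewrite mul1r lerDl.
rewrite /boundaryR /L mulr_suml -big_split/= big_seq [leRHS]big_seq; apply: ler_sum => e' el.
by rewrite -mulrDr ler_wpM2l ?enorm_ge0// hn.
Qed.

(** Fatou's lemma for the seminorm and for the boundary term, uniform convergence for the
    linear term; the four error terms are each [e / 4]. *)
Lemma limit_energyR M : admissible v ->
  (forall e, 0 < e -> \forall n \near \oo, energyR (v_ n) <= M + e) -> energyR v <= M.
Proof.
move=> adv hJ; apply/ler_addgt0Pr => e epos.
have e4 : 0 < e / 4 by rewrite divr_gt0.
have dp : 0 < delta / p by rewrite divr_gt0.
have e4p : 0 < p * (e / 4) by rewrite mulr_gt0.
have e4d : 0 < (delta / p)^-1 * (e / 4) by rewrite mulr_gt0// invr_gt0.
have h1 := limit_gagliardoR adv e4p; have h2 := limit_boundaryR adv e4d.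
have h3 := limit_source adv e4; have h4 := hJ _ e4.
near \oo => n.
have g1 : gagliardoR v <= gagliardoR (v_ n) + p * (e / 4) by near: n.
have g2 : boundaryR v <= boundaryR (v_ n) + (delta / p)^-1 * (e / 4) by near: n.
have g3 : `|source v - source (v_ n)| <= e / 4 by near: n.
have g4 : energyR (v_ n) <= M + e / 4 by near: n.
have ip : 0 < p^-1 by rewrite invr_gt0.
move: g1; rewrite -(ler_pM2l ip) mulrDr mulKf ?gt_eqF// => g1.
move: g2; rewrite -(ler_pM2l dp) mulrDr mulVKf ?gt_eqF// => g2.
exact: quarters g1 g2 g3 g4.
Unshelve. all: by end_near. Qed.

End Limit.

(** The energies exceed the infimum by [c0 * (n + 1)^(-p)], which makes the sequence uniformly
    Cauchy at the rate [1 / (n + 1)]. *)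
Lemma admissible_minimizer : exists2 v, admissible v & energyR v <= m.
Proof.
have [C C0 hC] := near_minimizers.
have hn n : exists u, admissible u /\ energyR u <= m + c0 * (n.+1%:R^-1) `^ p.
  have epos : 0 < c0 * (n.+1%:R^-1) `^ p by rewrite mulr_gt0// powR_gt0// invr_gt0.
  by have [_ [u au <-] /ltW hu] := inf_adherent epos has_inf_energies; exists u.
have [v_ hv] := choice hn.
have le_eta n j : (n <= j)%N -> m + c0 * (j.+1%:R^-1) `^ p <= m + c0 * (n.+1%:R^-1) `^ p.
  move=> nj; rewrite lerD2l ler_wpM2l ?(ltW c0_gt0)// ge0_ler_powR ?nnegrE ?(ltW p0)//.
  by rewrite lef_pV2 ?posrE// ler_nat.
have hd n j x : (n <= j)%N -> closure D x -> `|v_ n x - v_ j x| <= C / n.+1%:R.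
  move=> nj cx; have n0 : 0 < n.+1%:R^-1 :> R by rewrite invr_gt0.
  exact: (hC _ _ _ (hv n).1 (hv j).1 n0 (hv n).2 (le_trans (hv j).2 (le_eta _ _ nj)) x cx).
pose v x := limn (fun n => v_ n x).
have vv n x : closure D x -> `|v x - v_ n x| <= C / n.+1%:R.
  move=> cx.
  exact: (@cauchy_rate _ (fun n => v_ n x) C C0 (fun i j ij => hd i j x ij cx) n).
have av n := (hv n).1.
have [F F0 hF] := admissible_source_bounded.
have hG n : gagliardoR (v_ n) <= p * (m + c0 + F).
  have h1 := (hv n).2; have h2 := hF _ (av n).
  have h3 : 0 <= delta / p * boundaryR (v_ n).
    by rewrite mulr_ge0 ?boundaryR_ge0// divr_ge0// ltW.
  have h4 : c0 * (n.+1%:R^-1) `^ p <= c0.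
    rewrite ler_piMr ?(ltW c0_gt0)//.
    have [->|n0] := eqVneq n 0%N; first by rewrite invr1 powR1.
    apply: (@le_trans _ _ (1 `^ p)); last by rewrite powR1.
    by rewrite ge0_ler_powR ?nnegrE ?(ltW p0)// invf_le1 ?ler1n.
  rewrite -ler_pdivrMl//; move: h1 h2 h3 h4; rewrite /energyR.
  move: (p^-1 * gagliardoR (v_ n)) (source (v_ n)) (delta / p * _) (c0 * _ `^ _).
  by move=> a1 a2 a3 a4; exact: energy_upper.
have adv := limit_admissible C0 av vv hG.
exists v => //; apply: (limit_energyR C0 av vv adv) => e epos.
have [r0 /andP[r00 _] hr] := powR_small d0 p0 (ltW c0_gt0) epos.
have := near_infty_natSinv_lt (PosNum r00); apply: filterS => n /= hnr.
apply: (le_trans (hv n).2); rewrite lerD2l ltW// hr//.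
by rewrite invr_gt0 ltr0n/= ltW.
Qed.

End Infimum.

(** The problem on all of the obstacle set reduces to admissible functions by passing to
    traces, which changes neither the class nor the energy. *)
Theorem obstacle_minimizer : obstacle_set s p D phi1 phi2 !=set0 ->
  exists2 v, minimizer (obstacle_set s p D phi1 phi2) (energy s p D l f b delta) v &
    forall w, minimizer (obstacle_set s p D phi1 phi2) (energy s p D l f b delta) w ->
      {ae mu, forall x, D x -> w x = v x}.
Proof.
move=> [u0 Ku0].
have adm0 : exists u, admissible u by exists (trace D u0); exact: obstacle_admissible.
have [v av vm] := admissible_minimizer adm0.
have low w : admissible w -> energyR v <= energyR w.
  by move=> aw; apply: (le_trans vm); exact: inf_le.
have energy_le w : obstacle_set s p D phi1 phi2 w ->
    (energy s p D l f b delta v <= energy s p D l f b delta w)%E.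
  move=> Kw; have aw := obstacle_admissible Kw.
  have [Ww _ _] := Kw.
  by rewrite -(energy_trace Ww) (energyE av.1) (energyE aw.1) lee_fin low.
exists v; first by split; [exact: admissible_obstacle|exact: energy_le].
move=> w [Kw wmin]; have aw := obstacle_admissible Kw; have [Ww _ _] := Kw.
have hw := wmin v (admissible_obstacle av).
rewrite -(energy_trace Ww) (energyE av.1) (energyE aw.1) lee_fin in hw.
(* The trace of another minimizer is admissible and reaches the infimum. *)
have wm := le_trans hw vm.
apply: (ae_imp _ (trace_ae p1 sp2 mD d0 k0 Dd dens Ww)) => x h Dx; rewrite (h Dx).
by apply: (admissible_unique adm0 aw av wm vm); exact: subset_closure.
Qed.

End Energy.

(** * Sides of the Koch polygons *)

Section KochSides.
Variable R : realType.
Implicit Types (P Q z : R * R) (e : (R * R) * (R * R)).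

(** A similarity with nonzero factor: its determinant is the squared length of [e]. *)
Lemma place_inj e : e.1 != e.2 -> injective (place e).
Proof.
move=> eN [a b] [c d] [] h1 h2.
set u := e.2.1 - e.1.1 in h1 h2; set v := e.2.2 - e.1.2 in h1 h2.
have E1 : u * (a - c) - v * (b - d) = 0 by rewrite !mulrBr; lra.
have E2 : v * (a - c) + u * (b - d) = 0 by rewrite !mulrBr; lra.
have uv : u ^+ 2 + v ^+ 2 != 0.
  rewrite paddr_eq0 ?sqr_ge0// !sqrf_eq0 !subr_eq0; apply: contra eN.
  by case: e @u @v h1 h2 E1 E2 => [[? ?] [? ?]] /= _ _ _ _ /andP[/eqP -> /eqP ->].
have E3 : (u ^+ 2 + v ^+ 2) * (a - c) = 0.
  have -> : (u ^+ 2 + v ^+ 2) * (a - c) =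
    u * (u * (a - c) - v * (b - d)) + v * (v * (a - c) + u * (b - d)) by ring.
  by rewrite E1 E2 !mulr0 addr0.
have E4 : (u ^+ 2 + v ^+ 2) * (b - d) = 0.
  have -> : (u ^+ 2 + v ^+ 2) * (b - d) =
    u * (v * (a - c) + u * (b - d)) - v * (u * (a - c) - v * (b - d)) by ring.
  by rewrite E1 E2 !mulr0 subr0.
move/eqP: E3; rewrite mulf_eq0 (negbTE uv) subr_eq0 => /eqP ->.
by move/eqP: E4; rewrite mulf_eq0 (negbTE uv) subr_eq0 => /eqP ->.
Qed.

Lemma place0 e : place e (0, 0) = e.1.
Proof. by rewrite /place/= !mulr0 subr0 !addr0; case: e => [[]]. Qed.

Lemma place1 e : place e (1, 0) = e.2.
Proof. by case: e => [[a b] [c d]]; rewrite /place/=; congr pair; ring. Qed.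

Lemma place_neq e a b c d : e.1 != e.2 -> a < c -> place e (a, b) != place e (c, d).
Proof.
by move=> eN; apply: contraTN => /eqP/(place_inj eN)[-> _]; rewrite ltxx.
Qed.

(** The new vertices have distinct abscissas in the frame of [e]. *)
Lemma koch_split_nondegenerate e e' : e.1 != e.2 -> e' \in koch_split e -> e'.1 != e'.2.
Proof.
move=> eN; rewrite /koch_split !inE => /or4P[] /eqP -> /=.
- by rewrite -[X in X != _](place0 e); apply: place_neq => //; lra.
- by apply: place_neq => //; lra.
- by apply: place_neq => //; lra.
- by rewrite -[X in _ != X](place1 e); apply: place_neq => //; lra.
Qed.

Lemma triangle_sides_nondegenerate P Q e : P != Q -> e \in triangle_sides P Q -> e.1 != e.2.
Proof.
move=> PQ; rewrite /triangle_sides !inE => /or3P[] /eqP -> //=; rewrite eq_sym.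
- by rewrite -[X in _ != X](place1 (P, Q)); apply: place_neq => //; lra.
- by rewrite -[X in X != _](place0 (P, Q)); apply: place_neq => //; lra.
Qed.

Lemma koch_segments_nondegenerate P Q n e :
  P != Q -> e \in koch_segments P Q n -> e.1 != e.2.
Proof.
move=> PQ; elim: n e => [|n IH] e; first exact: triangle_sides_nondegenerate.
rewrite /koch_segments iterS => /flattenP[_ /mapP[e' /IH e'N ->]].
exact: koch_split_nondegenerate.
Qed.

Lemma koch_segments_neq0 P Q n : exists e, e \in koch_segments P Q n.
Proof.
elim: n => [|n [e el]]; first by exists (P, Q); rewrite mem_head.
exists (e.1, place e (3^-1, 0)); rewrite /koch_segments iterS.
apply/flattenP; exists (koch_split e); first exact: map_f.
by rewrite mem_head.
Qed.

End KochSides.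

Theorem theorem2p5 (R : realType) (s p : R)
    (s01 : 0 < s < 1) (p1 : 1 < p) (sp : 2 < s * p < p)
    (P Q : R * R) (PQ : P != Q) (K Om : set (R * R)) (Om_ : nat -> set (R * R))
    (snowflakeK : koch_snowflake P Q K)
    (domOm : bounded_domain_of K Om)
    (domOm_ : forall m : nat,
       bounded_domain_of (segments_union (koch_segments P Q m)) (Om_ m))
    (incOm_ : forall m : nat, Om_ m `<=` Om_ m.+1)
    (exhOm_ : \bigcup_m Om_ m = Om)
    (n : nat) (f b : R * R -> R) (delta : R) (phi1 phi2 : R * R -> R)
    (fL1 : (area R).-integrable Om (EFin \o f))
    (bcont : {within closure Om, continuous b})
    (bpos : forall x, closure Om x -> 0 < b x)
    (delta_gt0 : 0 < delta)
    (phi1W : sobolev s p Om phi1) (phi2W : sobolev s p Om phi2)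
    (phi12 : ae_le_on Om phi1 phi2)
    (Kn0 : obstacle_set s p (Om_ n) phi1 phi2 !=set0) :
  let J := energy s p (Om_ n) (koch_segments P Q n) f b delta in
  let Kn := obstacle_set s p (Om_ n) phi1 phi2 in
  exists2 v, minimizer Kn J v &
    forall w, minimizer Kn J w ->
      {ae area R, forall x, Om_ n x -> w x = v x}.
Proof.
move=> J Kn.
have /andP[sp2 spp] := sp.
have [oD _ bD bdD] := domOm_ n; have [oOm _ _ _] := domOm.
have DOm : Om_ n `<=` Om by rewrite -exhOm_ => x Dx; exists n.
have mD := open_measurable_plane oD; have mOm := open_measurable_plane oOm.
have cDOm := closureS DOm.
have [d d0 Dd] := bounded_enorm bD.
set l := koch_segments P Q n.
have l_neq e : e \in l -> e.1 != e.2 by exact: koch_segments_nondegenerate.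
have [k k0 dens] : exists2 k, 0 < k & measure_density k d (Om_ n) (closure (Om_ n)).
  apply: (measure_density_closure oD d0 _ l_neq).
    by move=> x Dx; apply: Dd; exact: subset_closure.
  move=> x; rewrite bdD => -[e el ex]; exists e => //; exact: side_segment.
have lD e : e \in l -> segment_set e `<=` closure (Om_ n).
  move=> el x ex; have : boundary (Om_ n) x by rewrite bdD; exists e.
  by case.
have [e0 e0l] := koch_segments_neq0 P Q n.
have cb : continuous_on (closure (Om_ n)) b.
  exact: continuous_onS cDOm (within_continuous_on bcont).
have p2 : 2 <= p by rewrite (le_trans (ltW sp2))// ltW.
have fi := integrableS mOm mD DOm fL1.
have b0 x : closure (Om_ n) x -> 0 < b x by move=> cx; apply: bpos; exact: cDOm.
have W1 := sobolevS mD mOm DOm phi1W.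
have W2 := sobolevS mD mOm DOm phi2W.
exact: (@obstacle_minimizer R s p (Om_ n) d k p2 sp2 mD d0 k0 Dd dens l lD f b delta
  fi cb b0 delta_gt0 e0 e0l (l_neq _ e0l) phi1 phi2 W1 W2 Kn0).
Qed.
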